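(* Suppose the constants $a,r$ in the prior satisfy $a>r\max\{1+\lambda,1,-\lambda\}$, and define \[ \rho_0=\frac{a+1}{a-r\max\{1+\lambda,1,-\lambda\}}>1 . \] Under Assumptions (A1)–(A3), for any $\rho>\rho_0$, letting $U_n=\{\beta\in\mathbb R^p:|S_\beta|\ge\rho s^\star\}$, we have $\sup_{\beta^\star}\mathsf E_{\beta^\star}\{\Pi^n(U_n)\}\to0$ as $n\to\infty$, where the supremum is over all $s^\star$-sparse $\beta^\star$ (satisfying (A2)).
   Context: Model: for each $n$, $Y=X\beta^\star+\varepsilon$ with $Y\in\mathbb R^n$, fixed design $X\in\mathbb R^{n\times p}$, true coefficient $\beta^\star\in\mathbb R^p$, $\varepsilon\sim\mathsf N_n(0,\sigma^2I_n)$ with $\sigma^2>0$ known; $\mathsf E_{\beta^\star},\mathsf P_{\beta^\star}$ refer to this distribution of $Y$. Asymptotics are in a triangular-array sense: $p=p_n$, $s^\star=s^\star_n$ and $R=R_n=\mathrm{rank}(X)$ may depend on $n$, with $s^\star\le R\le n\ll p$; $\lambda\in\mathbb R$, $g>0$, $\sigma^2$, $\alpha\in(0,1)$ and $a,c,C,r>0$ are fixed constants; $\phi=\phi_n\in(0,1)$. For a configuration $S\subseteq\{1,\dots,p\}$, $X_S$ is the submatrix of columns in $S$, $s=|S|$, $D(S)=\det(X_S^\top X_S)$, $\kappa(S)$ is the condition number of $X_S^\top X_S$ (equivalently of $n^{-1}X_S^\top X_S$), $\hat\beta_S=(X_S^\top X_S)^{-1}X_S^\top Y$, and $k_S=\mathrm{tr}\{(X_S^\top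 X_S)^{-1}\}/\mathrm{tr}\{(X_S^\top X_S)^{\lambda}\}$. For $\beta\in\mathbb R^p$, $S_\beta$ is its support; $S^\star=S_{\beta^\star}$, $s^\star=|S^\star|$, and $\beta^\star_{S^\star}$ is the vector of nonzero entries of $\beta^\star$. For $\beta_S\in\mathbb R^{|S|}$, $\beta_{S+}\in\mathbb R^p$ is obtained by filling zeros in coordinates outside $S$. Prior: $f_n(s)\propto c^{-s}p^{-as}$ for $s=0,1,\dots,R$; $\pi(S)=f_n(|S|)\,\pi(S\mid |S|)$ with $\pi(S\mid|S|=s)=D(S)^{-\lambda/(2s)}1\{\kappa(S)<Cp^r\}\big/\sum_{S':|S'|=s}D(S')^{-\lambda/(2s)}1\{\kappa(S')<Cp^r\}$; given $S$, $\pi(\beta_S\mid S)$ is the density of $\mathsf N\big(\phi\hat\beta_S,\ \sigma^2 g k_S (X_S^\top X_S)^{\lambda}\big)$. Posterior: $L_n(\beta)=(2\pi\sigma^2)^{-n/2}\exp\{-\|Y-X\beta\|^2/(2\sigma^2)\}$ and $R_n(\beta,\beta^\star)=L_n(\beta)/L_n(\beta^\star)$. For measurable $A\subseteq\mathbb R^p$, $N_n(A)=\sum_S\pi(S)\int_{\{\beta_S:\beta_{S+}\in A\}}R_n(\beta_{S+},\beta^\star)^{\alpha}\pi(\beta_S\mid S)\,d\beta_S$, $D_n=N_n(\mathbb R^p)$, and $\Pi^n(A)=N_n(A)/D_n$. Design quantities: $\lambda_{\min}(S),\lambda_{\max}(S)$ are the smallest and largest eigenvalues of $n^{-1}X_S^\top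 X_S$; $\ell(s)=\min_{|S|=s}\lambda_{\min}(S)$, $u(s)=\max_{|S|=s}\lambda_{\max}(S)$, $\omega(s)=\max_{|S|=s}\kappa(S)$. Assumptions: (A1) $s^\star=o(n)$. (A2) $s^\star\{n\|\beta^\star_{S^\star}\|\}^{-1}\to0$ and $1-\phi_n=O(s^\star\{n\|\beta^\star_{S^\star}\|\}^{-1})$. (A3) $0<\liminf_n\ell(s^\star)<\limsup_n u(s^\star)<\infty$. *)

(* Defs.v *)
From HB Require Import structures.
From mathcomp Require Import all_boot all_order all_algebra.
From mathcomp Require Import all_classical all_reals all_analysis.
Set Implicit Arguments. Unset Strict Implicit. Unset Printing Implicit Defensive.
Import Order.TTheory GRing.Theory Num.Theory.
Import numFieldNormedType.Exports.
Local Open Scope classical_set_scope.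
Local Open Scope ring_scope.

Section BayesDefs.
Context {R : realType}.

(** Lebesgue integral over R^m (column vectors), as the iterated
    Lebesgue integral (Tonelli; only used on nonnegative integrands). *)
Fixpoint lebn (m : nat) : ('cV[R]_m -> \bar R) -> \bar R :=
  match m with
  | 0 => fun f => f 0
  | k.+1 => fun f =>
      (\int[lebesgue_measure]_x lebn (fun v : 'cV[R]_k => f (col_mx (x%:M) v)))%E
  end.

Definition sqnorm m (v : 'cV[R]_m) : R := \sum_i (v i 0) ^+ 2.
Definition enorm m (v : 'cV[R]_m) : R := Num.sqrt (sqnorm v).

Definition supp p (v : 'cV[R]_p) : {set 'I_p} := [set i | v i 0 != 0].

Definition sel p (S : {set 'I_p}) : 'M[R]_(p, #|S|) :=
  \matrix_(i, j) (i == enum_val j)%:R.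
Definition subX n p (X : 'M[R]_(n, p)) (S : {set 'I_p}) : 'M[R]_(n, #|S|) :=
  X *m sel S.
Definition fillS p (S : {set 'I_p}) (b : 'cV[R]_#|S|) : 'cV[R]_p := sel S *m b.
Definition gram n p (X : 'M[R]_(n, p)) (S : {set 'I_p}) : 'M[R]_#|S| :=
  (subX X S)^T *m subX X S.
Definition Ddet n p (X : 'M[R]_(n, p)) (S : {set 'I_p}) : R := \det (gram X S).

Definition eigs s (A : 'M[R]_s) : set R := [set a | eigenvalue A a].
Definition lam_min s (A : 'M[R]_s) : R := inf (eigs A).
Definition lam_max s (A : 'M[R]_s) : R := sup (eigs A).
(** condition number (+oo for singular matrices; 1 for the empty matrix) *)
Definition cond s (A : 'M[R]_s) : \bar R :=
  if s == 0%N then 1%E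
  else if 0 < lam_min A then (lam_max A / lam_min A)%:E else +oo%E.

Definition ell n p (X : 'M[R]_(n, p)) (s : nat) : R :=
  inf [set lam_min ((n%:R)^-1 *: gram X S) | S in [set S : {set 'I_p} | #|S| = s]].
Definition uu n p (X : 'M[R]_(n, p)) (s : nat) : R :=
  sup [set lam_max ((n%:R)^-1 *: gram X S) | S in [set S : {set 'I_p} | #|S| = s]].

(** real power A^t of a symmetric positive definite matrix via its spectral
    decomposition A = U diag(d) U^T (U orthogonal, d > 0); 0 otherwise *)
Definition spec_dec s (A : 'M[R]_s) (UD : 'M[R]_s * 'rV[R]_s) : Prop :=
  [/\ UD.1^T *m UD.1 = 1%:M, (forall i, 0 < UD.2 0 i)
    & A = UD.1 *m diag_mx UD.2 *m UD.1^T].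
Definition mxpowr s (A : 'M[R]_s) (t : R) : 'M[R]_s :=
  match pselect (exists UD, spec_dec A UD) with
  | left H => let UD := projT1 (cid H) in
              UD.1 *m diag_mx (\row_i (UD.2 0 i `^ t)) *m UD.1^T
  | right _ => 0
  end.

Definition gauss_dens m (mu : 'cV[R]_m) (Sig : 'M[R]_m) (b : 'cV[R]_m) : R :=
  (Num.sqrt ((2 * pi) ^+ m * \det Sig))^-1 *
  expR (- (((b - mu)^T *m invmx Sig *m (b - mu)) 0 0) / 2).

Section Posterior.
Variables (n p : nat) (X : 'M[R]_(n, p)).
Variables (sigma2 lam g alpha a c C r phi : R).

Definition fsize_w (s : nat) : R := c `^ (- s%:R) * (p%:R) `^ (- (a * s%:R)).
Definition fsize (s : nat) : R :=
  if (s <= \rank X)%N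
  then fsize_w s / \sum_(t < (\rank X).+1) fsize_w t else 0.

Definition wS (S : {set 'I_p}) : R :=
  Ddet X S `^ (- lam / (2 * #|S|%:R)) *
  (if (cond (gram X S) < (C * (p%:R) `^ r)%:E)%E then 1 else 0).
Definition piS_cond (S : {set 'I_p}) : R :=
  wS S / \sum_(S' : {set 'I_p} | #|S'| == #|S|) wS S'.
Definition piS (S : {set 'I_p}) : R := fsize #|S| * piS_cond S.

Definition kS (S : {set 'I_p}) : R :=
  \tr (invmx (gram X S)) / \tr (mxpowr (gram X S) lam).
Definition betahat (S : {set 'I_p}) (Y : 'cV[R]_n) : 'cV[R]_#|S| :=
  invmx (gram X S) *m (subX X S)^T *m Y.
Definition prior_beta (S : {set 'I_p}) (Y : 'cV[R]_n) (b : 'cV[R]_#|S|) : R :=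
  gauss_dens (phi *: betahat S Y) ((sigma2 * g * kS S) *: mxpowr (gram X S) lam) b.

Definition Lik (Y : 'cV[R]_n) (beta : 'cV[R]_p) : R :=
  ((2 * pi * sigma2) `^ (n%:R / 2))^-1 * expR (- sqnorm (Y - X *m beta) / (2 * sigma2)).
Definition LR (Y : 'cV[R]_n) (beta bstar : 'cV[R]_p) : R :=
  Lik Y beta / Lik Y bstar.

Definition Nn (bstar : 'cV[R]_p) (Y : 'cV[R]_n) (A : set 'cV[R]_p) : \bar R :=
  (\sum_(S : {set 'I_p})
     (piS S)%:E *
     lebn (fun b : 'cV[R]_#|S| =>
             if `[< A (fillS b) >]
             then (LR Y (fillS b) bstar `^ alpha * @prior_beta S Y b)%:E
             else 0%E))%E.
Definition Dn (bstar : 'cV[R]_p) (Y : 'cV[R]_n) : \bar R := Nn bstar Y setT.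
Definition Post (bstar : 'cV[R]_p) (Y : 'cV[R]_n) (A : set 'cV[R]_p) : R :=
  fine (Nn bstar Y A) / fine (Dn bstar Y).

Definition EPost (bstar : 'cV[R]_p) (A : set 'cV[R]_p) : \bar R :=
  lebn (fun Y : 'cV[R]_n =>
          (gauss_dens (X *m bstar) (sigma2%:M) Y * Post bstar Y A)%:E).

End Posterior.

Definition Uset p (rho : R) (sstar : nat) : set 'cV[R]_p :=
  [set beta | rho * sstar%:R <= #|supp beta|%:R].

End BayesDefs.

(* Main.v *)
(* Pointwise in Y, the evidence of a model S is at most
   exp(-alpha (|Y - P_S Y|^2 - |Y - X beta^\star|^2) / (2 sigma^2)), since the
   empirical prior integrates to at most one, whereas the evidence of S^\star is
   bounded below by a constant to the power s^\star: there the prior covariance is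
   comparable to the inverse information by (A3), and its centring at
   phi betahat costs only exp(O(s^\star)) by (A2).  The posterior mass of U_n is
   therefore at most a deterministic combination of the exponentials above, and
   the expectation of each of these is a Gaussian integral bounded by
   (1 - alpha)^(-|S|/2).  As pi(S^\star) is at least f_n(s^\star) p^(-s^\star) up to
   constants, size s contributes at most (W p^(-(a - (a+1)/rho)))^s, and these
   terms are summed as a geometric series. *)
Require Import Defs.
From HB Require Import structures.
From mathcomp Require Import all_boot all_order all_algebra.
From mathcomp Require Import all_classical all_reals all_analysis.
From mathcomp Require Import measurable_realfun complex ring lra.
Import Order.TTheory GRing.Theory Num.Theory.
Import numFieldNormedType.Exports.
Local Open Scope classical_set_scope.
Local Open Scope ring_scope.

Set Implicit Arguments.
Unset Strict Implicit.
Unset Printing Implicit Defensive.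

(** * Spectral decomposition of real symmetric matrices *)

(** The denominator can be bounded for every Y, with no exceptional event. If P projects onto the
    columns of the true model, the residual at the true coefficient exceeds the least-squares
    residual by |P (Y - X beta^\star)|^2. This surplus absorbs the noise part of the cost of
    shrinking P Y by phi as soon as 4 (1 - phi)^2 <= 1, and only a signal part of order (1 - phi)^2
    n |beta^\star|^2 remains. A deterministic denominator can be taken out of the expectation, where
    alpha < 1 keeps 1 - alpha P positive definite. Integrals over several variables are iterated,
    and the posterior is not shown to be measurable in Y. So general integrands are only compared by
    monotonicity, and every integral that is evaluated is a finite sum of Gaussian exponentials,
    treated one coordinate at a time by Schur complements. The prior covariance contains a real
    power of the Gram matrix, read off a spectral decomposition picked by choice. Hence the real
    spectral theorem, to know that one exists, and estimates valid for an arbitrary one. *)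

Lemma trmxB (R : pzRingType) m n (A B : 'M[R]_(m, n)) : (A - B)^T = A^T - B^T.
Proof. by apply/matrixP => i j; rewrite !mxE. Qed.

Lemma trmxZ (R : pzRingType) m n (k : R) (A : 'M[R]_(m, n)) :
  (k *: A)^T = k *: A^T.
Proof. by apply/matrixP => i j; rewrite !mxE. Qed.

(** Over [R[i]] the matrix is hermitian, so its spectral diagonal is real. Being a root of the
    characteristic polynomial descends along the embedding, although the complex eigenvector need
    not be real. *)
Lemma symmetric_eigenvalue (R : rcfType) n (A : 'M[R]_n) :
  (0 < n)%N -> A^T = A -> exists a, eigenvalue A a.
Proof.
move=> n0 symA; pose f := real_complex R; pose B := map_mx f A.
have realB : B \is a mxOver Num.real.
  by apply/mxOverP => i j; rewrite mxE; apply/complex_realP; exists (A i j).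
have hermB : B \is hermsymmx.
  apply: realsym_hermsym realB; apply/is_hermitianmxP.
  by rewrite expr0 scale1r; apply/matrixP => i j; rewrite !mxE -[in LHS]symA mxE.
have /orthomx_spectralP specB := hermitian_normalmx hermB.
have /mxOverP/(_ ord0 (Ordinal n0)) /complex_realP[a aE] :=
  hermitian_spectral_diag_real hermB.
exists a; rewrite eigenvalue_root_char -(fmorph_root f) map_char_poly.
rewrite -eigenvalue_root_char -/B; apply/eigenvalueP.
have uP := spectral_unit B.
exists (row (Ordinal n0) (spectralmx B)); last first.
  apply/negP => /eqP r0.
  have : row (Ordinal n0) (spectralmx B *m invmx (spectralmx B)) = 0.
    by rewrite row_mul r0 mul0mx.
  rewrite mulmxV // => /rowP/(_ (Ordinal n0)); rewrite !mxE eqxx => /eqP.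
  by rewrite oner_eq0.
rewrite -row_mul {2}specB !mulmxA mulmxV // mul1mx row_mul row_diag_mx -scalemxAl -rowE.
by congr (_ *: _); rewrite aE.
Qed.

(** The reflection in the hyperplane orthogonal to [w = v - e] swaps the unit vectors [e] and [v];
    the case [v = e], where [w] vanishes, is apart. It serves to complete a unit vector to an
    orthonormal basis. *)
Lemma householder (R : realFieldType) n (v : 'cV[R]_(1 + n)) :
  v^T *m v = 1%:M ->
  exists H : 'M[R]_(1 + n), H^T *m H = 1%:M /\ H *m delta_mx 0 0 = v.
Proof.
move=> v1; pose e : 'cV[R]_(1 + n) := delta_mx 0 0; pose w := v - e.
have e1 : e^T *m e = 1%:M.
  rewrite /e trmx_delta mul_delta_mx; apply/matrixP => i j.
  by rewrite !ord1 !mxE.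
have [w0|w0] := eqVneq w 0.
  exists 1%:M; rewrite trmx1 !mul1mx; split=> //.
  by apply/esym/eqP; rewrite -subr_eq0; apply/eqP.
pose k : R := (w^T *m w) 0 0; pose t : R := (w^T *m e) 0 0.
have kE : w^T *m w = k%:M by exact: mx11_scalar.
have tE : w^T *m e = t%:M by exact: mx11_scalar.
(* Both vectors are unit, so |v - e|^2 = -2 (v - e) . e. This value makes the reflection send [e] to
   [e + w]. *)
have kt : k = - (t + t).
  have : (w^T *m w + w^T *m e + (w^T *m e)^T) 0 0 = 0 :> R.
    rewrite trmx_mul trmxK /w !trmxB !mulmxBl !mulmxBr v1 e1.
    rewrite (_ : v^T *m e = (e^T *m v)^T); last by rewrite trmx_mul trmxK.
    rewrite !mxE /=; ring.
  by rewrite kE tE !mxE /= => /eqP; rewrite -addrA addr_eq0 => /eqP.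
have k0 : k != 0.
  apply: contra w0 => /eqP kz; apply/eqP/colP => i; rewrite [RHS]mxE.
  have : \sum_i (w i 0) ^+ 2 = 0.
    rewrite -[RHS]kz /k mxE; apply: eq_bigr => j _.
    by rewrite !mxE expr2.
  move=> /eqP; rewrite psumr_eq0; last by move=> j _; rewrite sqr_ge0.
  by move=> /allP/(_ i); rewrite mem_index_enum sqrf_eq0 => /(_ isT)/eqP.
pose H : 'M[R]_(1 + n) := 1%:M - (2 / k) *: (w *m w^T).
have HT : H^T = H by rewrite /H trmxB trmxZ trmx_mul trmxK trmx1.
exists H; split.
  rewrite HT /H mulmxBl !mulmxBr !mul1mx mulmx1 -!scalemxAl -!scalemxAr.
  rewrite mulmxA -(mulmxA w) kE -mulmxA mul_scalar_mx -scalemxAr !scalerA.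
  rewrite (_ : 2 / k * (2 / k * k) = 2 / k + 2 / k); last by field.
  by rewrite scalerDl opprB addrK subrK.
rewrite /H -/e mulmxBl mul1mx -scalemxAl -mulmxA tE -/e.
have t0 : t != 0 by apply: contra k0 => /eqP tz; rewrite kt tz addr0 oppr0.
rewrite mul_mx_scalar scalerA (_ : 2 / k * t = -1); last first.
  by apply: (mulIf k0); rewrite mulrAC divfK // kt; ring.
by rewrite scaleN1r opprK /w addrC subrK.
Qed.

(** Deflation: a Householder matrix sends the first basis vector to a unit eigenvector, and
    conjugation by it leaves, by symmetry, the eigenvalue in a corner and a symmetric block for the
    induction. *)
Theorem real_spectral (R : rcfType) n (A : 'M[R]_n) : A^T = A ->
  exists (U : 'M[R]_n) (d : 'rV[R]_n),
    U^T *m U = 1%:M /\ A = U *m diag_mx d *m U^T.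
Proof.
elim: n A => [|n IH] A symA.
  by exists 1%:M, 0; split; apply/matrixP => -[].
move: A symA; rewrite -[n.+1]/(1 + n)%N => A symA.
have [a /eigenvalueP[u uA u0]] := symmetric_eigenvalue (ltn0Sn n) symA.
pose k := Num.sqrt ((u *m u^T) 0 0).
have uu : (u *m u^T) 0 0 = \sum_i (u 0 i) ^+ 2.
  by rewrite mxE; apply: eq_bigr => i _; rewrite mxE expr2.
have uugt : 0 < (u *m u^T) 0 0.
  rewrite lt_def uu sumr_ge0 ?andbT; last by move=> i _; exact: sqr_ge0.
  apply: contra u0; rewrite psumr_eq0; last by move=> j _; rewrite sqr_ge0.
  move=> /allP h; apply/eqP/rowP => i; rewrite [RHS]mxE.
  by have := h i; rewrite mem_index_enum sqrf_eq0 => /(_ isT)/eqP.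
have k0 : 0 < k by rewrite sqrtr_gt0.
pose v : 'cV[R]_(1 + n) := k^-1 *: u^T.
have v1 : v^T *m v = 1%:M.
  rewrite /v trmxZ trmxK -scalemxAl -scalemxAr scalerA [u *m _]mx11_scalar.
  rewrite -[X in X%:M](sqr_sqrtr (ltW uugt)) -/k scale_scalar_mx.
  by congr (_%:M); field; exact: lt0r_neq0.
have Av : A *m v = a *: v.
  by rewrite /v -scalemxAr -[A]symA -trmx_mul uA trmxZ !scalerA mulrC.
have [H [HH He]] := householder v1.
have HH' := mulmx1C HH.
have [M MH] : exists M : 'M[R]_(1 + n), M = H^T *m A *m H by eexists.
have symM : M^T = M by rewrite MH !trmx_mul trmxK symA mulmxA.
have Me : M *m delta_mx 0 0 = a *: delta_mx 0 (0 : 'I_1) :> 'cV[R]_(1 + n).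
  by rewrite MH -(mulmxA _ H) He -mulmxA Av -scalemxAr -He mulmxA HH mul1mx.
pose B := drsubmx M.
have Ml i : M i 0 = a *+ (i == 0).
  have /colP/(_ i) := Me; rewrite -colE !mxE => ->.
  by rewrite eqxx andbT mulr_natr.
have Mr i : M 0 i = a *+ (i == 0).
  by rewrite -Ml; have /matrixP/(_ i 0) := symM; rewrite mxE.
have l0 (i : 'I_1) : lshift n i = 0 by apply: val_inj; rewrite /= ord1.
have ME : M = block_mx a%:M 0 0 B.
  rewrite -[LHS]submxK /B; congr block_mx; apply/matrixP => i j.
  - by rewrite !mxE !l0 Ml !ord1.
  - by rewrite !mxE l0 Mr.
  - by rewrite !mxE l0 Ml.
have symB : B^T = B by rewrite /B trmx_drsub symM.
have [V [d [VV BE]]] := IH B symB.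
exists (H *m block_mx 1%:M 0 0 V), (row_mx a%:M d); split.
  rewrite trmx_mul -mulmxA (mulmxA _ H) HH mul1mx (tr_block_mx 1%:M) mulmx_block.
  by rewrite !trmx0 trmx1 !mul0mx !mulmx0 !addr0 !add0r VV mul1mx -scalar_mx_block.
rewrite diag_mx_row trmx_mul (tr_block_mx 1%:M) !mulmxA -[H *m _ *m _]mulmxA.
rewrite -[H *m _ *m _]mulmxA !mulmx_block.
rewrite !trmx0 trmx1 !mul0mx !mulmx0 !addr0 !add0r mul1mx mulmx1 !mul0mx -BE.
have -> : diag_mx a%:M = a%:M :> 'M[R]_1.
  by apply/matrixP => i j; rewrite !ord1 !mxE.
by rewrite -ME MH !mulmxA HH' mul1mx -mulmxA HH' mulmx1.
Qed.

(** * Quadratic forms *)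

Definition qform (R : pzRingType) n (A : 'M[R]_n) (v : 'cV[R]_n) : R :=
  (v^T *m A *m v) 0 0.

Definition posdef (R : numDomainType) n (A : 'M[R]_n) :=
  A^T = A /\ forall v, v != 0 -> 0 < qform A v.

Definition specmx (R : pzRingType) n (U : 'M[R]_n) (d : 'rV[R]_n) : 'M[R]_n :=
  U *m diag_mx d *m U^T.

Lemma sqnormE (R : realType) n (v : 'cV[R]_n) : sqnorm v = (v^T *m v) 0 0.
Proof. by rewrite mxE; apply: eq_bigr => i _; rewrite mxE expr2. Qed.

Lemma sqnorm_ge0 (R : realType) n (v : 'cV[R]_n) : 0 <= sqnorm v.
Proof. by rewrite sumr_ge0 // => i _; exact: sqr_ge0. Qed.

Lemma sqnorm_gt0 (R : realType) n (v : 'cV[R]_n) : v != 0 -> 0 < sqnorm v.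
Proof.
rewrite lt_def sqnorm_ge0 andbT; apply: contra.
rewrite psumr_eq0; last by move=> i _; exact: sqr_ge0.
move=> /allP h; apply/eqP/colP => i; rewrite [RHS]mxE.
by have := h i; rewrite mem_index_enum sqrf_eq0 => /(_ isT)/eqP.
Qed.

Lemma sqnormB (R : realType) n (u v : 'cV[R]_n) :
  sqnorm (u - v) = sqnorm u - 2 * (u^T *m v) 0 0 + sqnorm v.
Proof.
rewrite mxE /sqnorm mulr_sumr -sumrB -big_split; apply: eq_bigr => i _ /=.
by rewrite !mxE; ring.
Qed.

Lemma sqnormN (R : realType) n (u : 'cV[R]_n) : sqnorm (- u) = sqnorm u.
Proof. by apply: eq_bigr => i _; rewrite mxE sqrrN. Qed.

Lemma sqnormB_le (R : realType) n (u v : 'cV[R]_n) :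
  sqnorm (u - v) <= 2 * sqnorm u + 2 * sqnorm v.
Proof.
rewrite /sqnorm !mulr_sumr -big_split; apply: ler_sum => i _ /=.
by rewrite !mxE; have := sqr_ge0 (u i 0 + v i 0); rewrite !expr2; lra.
Qed.

Lemma sqnormZ (R : realType) n (k : R) (u : 'cV[R]_n) :
  sqnorm (k *: u) = k ^+ 2 * sqnorm u.
Proof. by rewrite /sqnorm mulr_sumr; apply: eq_bigr => i _; rewrite mxE exprMn. Qed.

Lemma qform_mulmx (R : realType) m n (A : 'M[R]_(m, n)) (v : 'cV[R]_n) :
  qform (A^T *m A) v = sqnorm (A *m v).
Proof. by rewrite sqnormE /qform trmx_mul !mulmxA. Qed.

Lemma qform_conj (R : comPzRingType) n (A B : 'M[R]_n) v :
  qform (B^T *m A *m B) v = qform A (B *m v).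
Proof. by rewrite /qform trmx_mul !mulmxA. Qed.

Lemma qform_diag (R : comPzRingType) n (d : 'rV[R]_n) v :
  qform (diag_mx d) v = \sum_i d 0 i * v i 0 ^+ 2.
Proof.
rewrite /qform mul_mx_diag mxE; apply: eq_bigr => i _.
by rewrite !mxE expr2; ring.
Qed.

Lemma qformZ (R : comPzRingType) n k (A : 'M[R]_n) v :
  qform (k *: A) v = k * qform A v.
Proof. by rewrite /qform -scalemxAr -scalemxAl mxE. Qed.

Lemma posdefZ (R : numDomainType) n k (A : 'M[R]_n) :
  0 < k -> posdef A -> posdef (k *: A).
Proof.
move=> k0 [sA pA]; split; first by rewrite trmxZ sA.
by move=> v v0; rewrite qformZ mulr_gt0 // pA.
Qed.

Lemma posdef_unit (R : numFieldType) n (A : 'M[R]_n) : posdef A -> A \in unitmx.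
Proof.
move=> [_ pA]; rewrite unitmxE unitfE; apply/negP => /det0P[v v0 vA].
have := pA v^T; rewrite /qform trmxK vA mul0mx mxE ltxx; apply/implyP.
apply: contra v0 => /eqP v0.
by rewrite -[v]trmxK v0 trmx0.
Qed.

Lemma invmx_eq (R : comUnitRingType) n (A B : 'M[R]_n) :
  A *m B = 1%:M -> invmx A = B.
Proof.
move=> AB; have [uA _] := mulmx1_unit AB.
by rewrite -[LHS]mulmx1 -AB mulKmx.
Qed.

Section SpecMx.
Variables (R : numFieldType) (n : nat) (U : 'M[R]_n).
Hypothesis UU : U^T *m U = 1%:M.
Implicit Types d : 'rV[R]_n.

Lemma specmx_qform d v :
  qform (specmx U d) v = \sum_i d 0 i * (U^T *m v) i 0 ^+ 2.
Proof. by rewrite -qform_diag -qform_conj trmxK. Qed.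

Lemma specmx_sym d : (specmx U d)^T = specmx U d.
Proof. by rewrite /specmx !trmx_mul trmxK tr_diag_mx mulmxA. Qed.

Lemma specmxM d e :
  specmx U d *m specmx U e = specmx U (\row_i (d 0 i * e 0 i)).
Proof.
rewrite /specmx -mulmxA !(mulmxA U^T) UU mul1mx !mulmxA -(mulmxA U) mulmx_diag.
by [].
Qed.

Lemma specmx1 : specmx U (const_mx 1) = 1%:M.
Proof. by rewrite /specmx diag_const_mx mulmx1; exact: mulmx1C. Qed.

Lemma specmx_inv d : (forall i, d 0 i != 0) ->
  invmx (specmx U d) = specmx U (\row_i (d 0 i)^-1).
Proof.
move=> d0; apply: invmx_eq; rewrite specmxM -specmx1; congr specmx.
by apply/rowP => i; rewrite !mxE divff.
Qed.

Lemma specmx_det d : \det (specmx U d) = \prod_i d 0 i.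
Proof.
rewrite /specmx !det_mulmx det_diag mulrC mulrA -det_mulmx UU det1 mul1r.
by [].
Qed.

Lemma specmx_tr d : \tr (specmx U d) = \sum_i d 0 i.
Proof. by rewrite /specmx mxtrace_mulC mulmxA UU mul1mx mxtrace_diag. Qed.

Lemma specmxZ k d : k *: specmx U d = specmx U (k *: d).
Proof. by rewrite /specmx linearZ /= -scalemxAr -scalemxAl. Qed.

End SpecMx.

Lemma specmx_posdef (R : realType) n (U : 'M[R]_n) (d : 'rV[R]_n) :
  U^T *m U = 1%:M -> (forall i, 0 < d 0 i) -> posdef (specmx U d).
Proof.
move=> UU d0; split; first exact: specmx_sym.
move=> v v0; rewrite specmx_qform lt_def sumr_ge0 ?andbT; last first.
  by move=> i _; rewrite mulr_ge0 ?sqr_ge0 // ltW.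
rewrite psumr_eq0; last by move=> i _; rewrite mulr_ge0 ?sqr_ge0 // ltW.
apply: contra v0 => /allP h; have w0 : U^T *m v = 0.
  apply/colP => i; rewrite [RHS]mxE; apply/eqP.
  have := h i; rewrite mem_index_enum mulf_eq0 sqrf_eq0 => /(_ isT).
  by rewrite gt_eqF.
by rewrite -[v]mul1mx -(mulmx1C UU) -mulmxA w0 mulmx0.
Qed.

(** Sylvester's identity, from the lower-upper and upper-lower factorisations of one block
    matrix. *)
Lemma det_1Bmulmx (R : comPzRingType) m n (A : 'M[R]_(m, n)) (B : 'M[R]_(n, m)) :
  \det (1%:M - A *m B) = \det (1%:M - B *m A).
Proof.
have h1 : block_mx 1%:M A B 1%:M =
    block_mx 1%:M 0 B 1%:M *m block_mx 1%:M A 0 (1%:M - B *m A).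
  by rewrite mulmx_block !mul1mx !mul0mx mulmx1 !addr0 (addrC (B *m A)) subrK.
have h2 : block_mx 1%:M A B 1%:M =
    block_mx 1%:M A 0 1%:M *m block_mx (1%:M - A *m B) 0 B 1%:M.
  by rewrite mulmx_block !mul1mx !mul0mx mulmx1 !add0r subrK.
have := congr1 determinant h1; rewrite h2 !det_mulmx !det_ublock !det_lblock.
by rewrite !det1 !mul1r !mulr1.
Qed.

(** [s] is the Schur complement of the lower right block [B]; the congruence by [T] clears the
    off-diagonal blocks. The first coordinate then only shifts the centre of the form in the others,
    as integrating one coordinate at a time requires. *)
Lemma posdef_schur (R : realFieldType) n (A : 'M[R]_(1 + n)) : posdef A ->
  exists (s : R) (b : 'cV[R]_n) (B : 'M[R]_n),
  [/\ 0 < s, posdef B, \det A = s * \det B &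
      forall (x : R) (y : 'cV[R]_n),
        qform A (col_mx x%:M y) = s * x ^+ 2 + qform B (y + x *: b)].
Proof.
move=> [sA pA]; pose B := drsubmx A; pose w := dlsubmx A.
have AE : A = block_mx (ulsubmx A) w^T w B.
  by rewrite -[LHS]submxK /w -[in RHS]sA trmx_dlsub trmxK sA.
have pB : posdef B.
  split; first by rewrite /B trmx_drsub sA.
  move=> v v0; have := pA (col_mx 0 v); rewrite /qform {1}AE tr_col_mx.
  rewrite mul_row_block mul_row_col !trmx0 !mul0mx mulmx0 !add0r; apply.
  apply: contra v0 => /eqP/(congr1 dsubmx); rewrite col_mxKd => ->.
  by apply/eqP/matrixP => i j; rewrite !mxE.
have uB := posdef_unit pB; have sB := pB.1.
pose b := invmx B *m w.
have Bb : B *m b = w by rewrite /b mulKVmx.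
have bB : b^T *m B = w^T by rewrite -[B]sB -trmx_mul Bb.
pose s := (ulsubmx A - b^T *m w) 0 0.
have sE : ulsubmx A - b^T *m w = s%:M by exact: mx11_scalar.
pose T : 'M[R]_(1 + n) := block_mx 1%:M 0 b 1%:M.
have AT : A = T^T *m block_mx s%:M 0 0 B *m T.
  rewrite /T (tr_block_mx 1%:M) !trmx1 trmx0 !mulmx_block.
  rewrite !mul1mx !mul0mx !mulmx0 !mulmx1 !addr0 !add0r bB Bb.
  rewrite {1}AE; congr block_mx; rewrite -sE -bB -mulmxA Bb subrK //.
have qA x y : qform A (col_mx x%:M y) = s * x ^+ 2 + qform B (y + x *: b).
  rewrite AT qform_conj /T mul_block_col !mul1mx mul0mx addr0.
  rewrite /qform tr_col_mx mul_row_block mul_row_col !mulmx0 addr0 add0r.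
  rewrite [b *m _]mul_mx_scalar (addrC (x *: b)) tr_scalar_mx -!scalar_mxM.
  by rewrite [LHS]mxE; congr (_ + _); rewrite mxE mulr1n; ring.
exists s, b, B; split => //.
  have := pA (col_mx 1%:M (- b)); rewrite qA scale1r addNr /qform mulmx0 mxE.
  rewrite expr1n mulr1 addr0; apply; apply/negP => /eqP/(congr1 usubmx).
  by rewrite col_mxKu => /matrixP/(_ 0 0)/eqP; rewrite !mxE oner_eq0.
rewrite AT !det_mulmx det_tr /T det_lblock !det1 !mul1r mulr1 det_ublock.
by rewrite det_scalar1.
Qed.

Lemma posdef_det (R : realFieldType) n (A : 'M[R]_n) : posdef A -> 0 < \det A.
Proof.
elim: n A => [|n IH] A; first by rewrite det_mx00.
by move=> /(@posdef_schur _ n)[s [b [B [s0 pB -> _]]]]; rewrite mulr_gt0 // IH.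
Qed.

(** * Gaussian integrals *)

(* No measurability is needed: the integral of a nonnegative function is the
   supremum of the integrals of the simple functions below it. *)
Lemma ge0_le_integralT d (T : measurableType d) (R : realType)
    (mu : {measure set T -> \bar R}) (f1 f2 : T -> \bar R) :
  (forall x, 0 <= f1 x)%E -> (forall x, f1 x <= f2 x)%E ->
  (\int[mu]_x f1 x <= \int[mu]_x f2 x)%E.
Proof.
move=> f0 fg; have g0 x : (0 <= f2 x)%E by exact: le_trans (fg x).
rewrite !ge0_integralTE //; apply: ereal_sup_le => _ [h hf <-].
by exists h => // x; exact: le_trans (hf x) (fg x).
Qed.

Section Lebn.
Context {R : realType}.
Local Notation mu := (@lebesgue_measure R).

Lemma lebn_ge0 m (f : 'cV[R]_m -> \bar R) : (forall v, 0 <= f v)%E ->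
  (0 <= lebn f)%E.
Proof.
by elim: m f => [|m IH] f f0 /=; [exact: f0|apply: integral_ge0 => x _; exact: IH].
Qed.

Lemma le_lebn m (f1 f2 : 'cV[R]_m -> \bar R) : (forall v, 0 <= f1 v)%E ->
  (forall v, f1 v <= f2 v)%E -> (lebn f1 <= lebn f2)%E.
Proof.
elim: m f1 f2 => [|m IH] f1 f2 f0 f12 /=; first exact: f12.
by apply: ge0_le_integralT => x; [exact: lebn_ge0|exact: IH].
Qed.

Lemma measurable_gauss (c s m : R) :
  measurable_fun setT (fun x : R => c * expR (- (s * (x - m) ^+ 2) / 2)).
Proof.
apply: measurable_funM => //; apply: measurableT_comp => //.
apply: measurable_funM => //; apply: measurableT_comp => //.
apply: measurable_funM => //; apply: measurable_funX => //.
exact: measurable_funB.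
Qed.

Lemma integral_gauss1 (c s m : R) : 0 <= c -> 0 < s ->
  (\int[mu]_x (c * expR (- (s * (x - m) ^+ 2) / 2))%:E)%E =
  (c * Num.sqrt (2 * pi / s))%:E.
Proof.
move=> c0 s0; pose sg := Num.sqrt s^-1.
have sg0 : sg != 0 by rewrite gt_eqF // sqrtr_gt0 invr_gt0.
have sg2 : sg ^+ 2 = s^-1 by rewrite sqr_sqrtr // invr_ge0 ltW.
pose K := Num.sqrt (2 * pi / s).
have K0 : 0 < K.
  by rewrite sqrtr_gt0 divr_gt0 // mulr_gt0 // pi_gt0.
have E x : (c * expR (- (s * (x - m) ^+ 2) / 2))%:E =
    ((c * K)%:E * (normal_pdf m sg x)%:E)%E.
  rewrite normal_pdfE //= /normal_peak /normal_fun sg2 -EFinM; congr _%:E.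
  have -> : s^-1 * pi *+ 2 = 2 * pi / s by rewrite -mulr_natl; ring.
  rewrite -/K -mulrA mulVKf ?gt_eqF //; congr (_ * expR _).
  by rewrite -mulr_natl; field; exact: lt0r_neq0.
under eq_integral do rewrite E.
rewrite ge0_integralZl_EFin //=; last 3 first.
- by move=> x _; rewrite lee_fin normal_pdf_ge0.
- by apply/measurable_EFinP; exact: measurable_normal_pdf.
- by rewrite mulr_ge0 // ltW.
by rewrite integral_normal_pdf mule1.
Qed.

Lemma col_mx_subE k (x : R) (v : 'cV[R]_k) (m : 'cV[R]_(1 + k)) :
  col_mx x%:M v - m = col_mx (x - usubmx m 0 0)%:M (v - dsubmx m).
Proof.
rewrite -{1}[m]vsubmxK opp_col_mx add_col_mx {1}[usubmx m]mx11_scalar.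
by rewrite -raddfB.
Qed.

(** A whole finite sum is treated at once, because additivity is used only for explicit
    one-dimensional Gaussians, whose measurability is known. *)
Lemma lebn_gauss k (I : finType) (c : I -> R) (A : I -> 'M[R]_k)
    (m : I -> 'cV[R]_k) :
  (forall i, 0 <= c i) -> (forall i, posdef (A i)) ->
  lebn (fun v => (\sum_i c i * expR (- qform (A i) (v - m i) / 2))%:E) =
  (\sum_i c i * Num.sqrt ((2 * pi) ^+ k / \det (A i)))%:E.
Proof.
elim: k c A m => [|k IH] c A m c0 pA /=.
  congr _%:E; apply: eq_bigr => i _.
  rewrite det_mx00 expr0 divr1 sqrtr1 (_ : qform _ _ = 0); last first.
    by rewrite /qform mxE big_ord0.
  by rewrite oppr0 mul0r expR0.
have /choice[f fP] : forall i, exists t : R * 'cV[R]_k * 'M[R]_k,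
    [/\ 0 < t.1.1, posdef t.2, \det (A i) = t.1.1 * \det t.2 &
      forall (x : R) (y : 'cV[R]_k), qform (A i) (col_mx x%:M y : 'cV[R]_(1 + k)) =
        t.1.1 * x ^+ 2 + qform t.2 (y + x *: t.1.2)].
  move=> i; have [s [b [B [h1 h2 h3 h4]]]] := @posdef_schur _ k _ (pA i).
  by exists (s, b, B).
pose s i := (f i).1.1; pose b i := (f i).1.2; pose B i := (f i).2.
pose mu1 i := usubmx (m i : 'cV[R]_(1 + k)) 0 0.
pose mu2 i := dsubmx (m i : 'cV[R]_(1 + k)).
have inner x : lebn (fun v : 'cV[R]_k =>
    (\sum_i c i * expR (- qform (A i) (col_mx x%:M v - m i) / 2))%:E) =
    (\sum_i (c i * Num.sqrt ((2 * pi) ^+ k / \det (B i))) *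
      expR (- (s i * (x - mu1 i) ^+ 2) / 2))%:E.
  (* The inner centre depends on [x], but the value of the inner integral does not depend on its
     centre. *)
  pose c' i := c i * expR (- (s i * (x - mu1 i) ^+ 2) / 2).
  pose m' i := mu2 i - (x - mu1 i) *: b i.
  transitivity (lebn (fun v : 'cV[R]_k =>
      (\sum_i c' i * expR (- qform (B i) (v - m' i) / 2))%:E)).
    congr lebn; apply/funext => v; congr _%:E; apply: eq_bigr => i _.
    have -> : col_mx x%:M v - m i =
        col_mx (x - mu1 i)%:M (v - mu2 i) :> 'cV[R]_(1 + k).
      exact: col_mx_subE.
    have [_ _ _ ->] := fP i; rewrite -/(s i) -/(B i) -/(b i) /c' -mulrA -expRD.
    congr (_ * expR _); rewrite -mulrDl -opprD; congr (- (_ + qform _ _) / _).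
    by rewrite /m' opprB [in RHS]addrA (addrAC v).
  rewrite IH => [|i|i].
  - by congr _%:E; apply: eq_bigr => i _; rewrite /c' mulrAC.
  - by rewrite mulr_ge0 // expR_ge0.
  - by have [] := fP i.
under eq_integral do rewrite inner -sumEFin.
have cs i : 0 <= c i * Num.sqrt ((2 * pi) ^+ k / \det (B i)).
  by rewrite mulr_ge0 // sqrtr_ge0.
rewrite ge0_integral_sum //; last 2 first.
- by move=> i; apply/measurable_EFinP; exact: measurable_gauss.
- by move=> i x _; rewrite lee_fin mulr_ge0 // expR_ge0.
rewrite -sumEFin; apply: eq_bigr => i _.
have [s0 pB dA _] := fP i.
rewrite integral_gauss1 // -mulrA -sqrtrM; last first.
  by rewrite divr_ge0 ?exprn_ge0 ?mulr_ge0 ?pi_ge0 // ltW // posdef_det.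
congr (c i * Num.sqrt _)%:E; rewrite dA exprS /s /B.
have := posdef_det pB; have := s0; move: (f i).1.1 (\det _) => x y x0 y0.
by field; rewrite !gt_eqF.
Qed.

End Lebn.

(** * Orthogonal projections P and the quadratic forms 1 - al P *)

Section Projection.
Context {R : realType}.

Lemma pythagoras n (P : 'M[R]_n) u : P^T = P -> P *m P = P ->
  sqnorm u = sqnorm (u - P *m u) + sqnorm (P *m u).
Proof.
move=> sP PP; have E : (u^T *m (P *m u)) 0 0 = sqnorm (P *m u).
  by rewrite -qform_mulmx sP PP /qform mulmxA.
by rewrite sqnormB E; ring.
Qed.

Lemma qform_1Bproj n (P : 'M[R]_n) al u : P^T = P -> P *m P = P ->
  qform (1%:M - al *: P) u = sqnorm (u - P *m u) + (1 - al) * sqnorm (P *m u).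
Proof.
move=> sP PP; have E : qform P u = sqnorm (P *m u).
  by rewrite -qform_mulmx sP PP.
rewrite mulrBl mul1r addrA -pythagoras // -E -qformZ.
rewrite /qform mulmxBr mulmx1 mulmxBl [LHS]mxE sqnormE; congr (_ + _).
by rewrite mxE.
Qed.

Lemma posdef_1Bproj n (P : 'M[R]_n) al : al < 1 -> P^T = P -> P *m P = P ->
  posdef (1%:M - al *: P).
Proof.
move=> al1 sP PP; split; first by rewrite trmxB trmxZ sP trmx1.
move=> v v0; rewrite qform_1Bproj //.
have := sqnorm_gt0 v0; rewrite (pythagoras v sP PP).
have := sqnorm_ge0 (v - P *m v); have := sqnorm_ge0 (P *m v).
move: (sqnorm _) (sqnorm _) => x y x0 y0 xy.
have [z|y1] := eqVneq y 0; first by move: xy; rewrite z; lra.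
suff : 0 < (1 - al) * y by lra.
by rewrite mulr_gt0 ?subr_gt0 // lt_def y1.
Qed.

(* Completing the square; the discarded constant term is nonnegative. *)
Lemma qform_1Bproj_le n (P : 'M[R]_n) al (mu y : 'cV[R]_n) :
  0 <= al <= 1 -> P^T = P -> P *m P = P ->
  qform (1%:M - al *: P) (y - ((1 - al) *: mu + al *: (P *m mu))) <=
  (1 - al) * sqnorm (y - mu) + al * sqnorm (y - P *m y).
Proof.
move=> /andP[al0 al1] sP PP; rewrite qform_1Bproj // (pythagoras (y - mu) sP PP).
set m := _ + al *: _.
have Pm : P *m m = P *m mu.
  by rewrite mulmxDr -!scalemxAr mulmxA PP -scalerDl subrK scale1r.
rewrite !mulmxBr Pm.
suff : sqnorm (y - m - (P *m y - P *m mu)) <=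
    (1 - al) * sqnorm (y - mu - (P *m y - P *m mu)) + al * sqnorm (y - P *m y).
  by rewrite mulrDr; lra.
rewrite /m; move: (P *m y) (P *m mu) => Py Pmu.
rewrite /sqnorm !mulr_sumr -big_split /=; apply: ler_sum => i _.
rewrite !mxE; move: (y i 0) (mu i 0) (Py i 0) (Pmu i 0) => a b c d.
rewrite -subr_ge0.
rewrite (_ : _ - _ = al * (1 - al) * (b - d) ^+ 2); last by ring.
by rewrite mulr_ge0 ?sqr_ge0 // mulr_ge0 // subr_ge0.
Qed.

Variables (n s : nat) (Z : 'M[R]_(n, s)).
(** The hat matrix of least squares. [invmx] returns a singular matrix unchanged, so the projection
    property is claimed only under [uG]. *)
Definition proj_col : 'M[R]_n := Z *m invmx (Z^T *m Z) *m Z^T.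
Hypothesis uG : Z^T *m Z \in unitmx.

Lemma proj_col_sym : proj_col^T = proj_col.
Proof. by rewrite /proj_col !trmx_mul trmxK trmx_inv trmx_mul trmxK mulmxA. Qed.

Lemma proj_colK : proj_col *m Z = Z.
Proof. by rewrite /proj_col -mulmxA -mulmxA mulVmx ?mulmx1. Qed.

Lemma proj_col_idem : proj_col *m proj_col = proj_col.
Proof. by rewrite {2 3}/proj_col !mulmxA proj_colK. Qed.

(** Sylvester's identity moves the determinant from size n to size s, where the factors multiply to
    the identity. *)
Lemma det_1Bproj_col al : \det (1%:M - al *: proj_col) = (1 - al) ^+ s.
Proof.
rewrite /proj_col -mulmxA scalemxAl det_1Bmulmx -scalemxAr -mulmxA mulVmx //.
by rewrite scalemx1 -raddfB det_scalar.
Qed.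

Lemma residual_split (y : 'cV[R]_n) (b : 'cV[R]_s) :
  sqnorm (y - Z *m b) =
  sqnorm (y - proj_col *m y) + sqnorm (proj_col *m y - Z *m b).
Proof.
rewrite (pythagoras _ proj_col_sym proj_col_idem) mulmxBr mulmxA proj_colK.
by congr (sqnorm _ + _); rewrite opprB addrA subrK.
Qed.

End Projection.

(** * Gaussian expectation of the likelihood-ratio bounds *)

Section Gauss.
Context {R : realType}.

Lemma posdef1 n : posdef (1%:M : 'M[R]_n).
Proof.
split=> [|v v0]; first by rewrite trmx1.
by rewrite /qform mulmx1 -sqnormE sqnorm_gt0.
Qed.

Lemma posdef_inv n (A : 'M[R]_n) : posdef A -> posdef (invmx A).
Proof.
move=> pA; have uA := posdef_unit pA; have sA := pA.1.
have sI : (invmx A)^T = invmx A by rewrite trmx_inv sA.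
split=> // v v0.
have -> : invmx A = (invmx A)^T *m A *m invmx A by rewrite sI mulVmx // mul1mx.
rewrite qform_conj; apply: pA.2; apply: contra v0 => /eqP h.
by rewrite -[v]mul1mx -(mulmxV uA) -mulmxA h mulmx0.
Qed.

Lemma lebn_gauss_dens k (c : R) (mu : 'cV[R]_k) (Sig : 'M[R]_k) : 0 <= c ->
  posdef Sig -> lebn (fun b => (c * gauss_dens mu Sig b)%:E) = c%:E.
Proof.
move=> c0 pS; have dS := posdef_det pS.
pose K := Num.sqrt ((2 * pi) ^+ k * \det Sig).
have K0 : 0 < K.
  by rewrite sqrtr_gt0 mulr_gt0 // exprn_gt0 // mulr_gt0 // pi_gt0.
have := @lebn_gauss R k unit (fun=> c / K) (fun=> invmx Sig) (fun=> mu) _ _.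
rewrite big_const card_unit /= addr0 det_inv invrK -/K divfK ?gt_eqF // => <-.
- congr lebn; apply/funext => b; rewrite big_const card_unit /= addr0.
  by rewrite /gauss_dens -/K mulrA /qform.
- by move=> _; rewrite divr_ge0 // ltW.
- by move=> _; exact: posdef_inv.
Qed.

Lemma gauss_dens_iso n (mu y : 'cV[R]_n) s2 :
  gauss_dens mu (s2%:M) y =
  (Num.sqrt ((2 * pi) ^+ n * s2 ^+ n))^-1 * expR (- (sqnorm (y - mu) / s2) / 2).
Proof.
rewrite /gauss_dens det_scalar invmx_scalar mul_mx_scalar.
by rewrite -scalemxAl mxE -sqnormE [s2^-1 * _]mulrC.
Qed.

Lemma gauss_dens_ge0 k (mu b : 'cV[R]_k) (Sig : 'M[R]_k) : 0 <= gauss_dens mu Sig b.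
Proof. by rewrite mulr_ge0 ?expR_ge0 // invr_ge0 sqrtr_ge0. Qed.

Lemma sqrtr_exp (x : R) k : 0 <= x -> Num.sqrt (x ^+ k) = Num.sqrt x ^+ k.
Proof.
move=> x0; elim: k => [|k IH]; first by rewrite !expr0 sqrtr1.
by rewrite !exprS sqrtrM // IH.
Qed.

(** The exponents add up to -((1 - al) |y - mu|^2 + al |y - P y|^2) / (2 s2). Completing the square
    bounds this by a Gaussian exponent of precision (1 - al P) / s2, whose determinant supplies the
    power of 1 - al. No relation between [mu] and the columns of [S] enters. *)
Lemma lebn_lik_ratio n p (X : 'M[R]_(n, p)) (mu : 'cV[R]_n) s2 al
    (w : {set 'I_p} -> R) : 0 < s2 -> 0 < al < 1 ->
  (forall S, 0 <= w S) ->
  (forall S, w S != 0 -> gram X S \in unitmx) ->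
  (lebn (fun y : 'cV[R]_n => (\sum_S w S * (gauss_dens mu (s2%:M) y *
     expR (- (al * (sqnorm (y - proj_col (subX X S) *m y) - sqnorm (y - mu)))
       / (2 * s2))))%:E) <=
   (\sum_S w S * (Num.sqrt (1 - al))^-1 ^+ #|S|)%:E)%E.
Proof.
move=> s20 /andP[al0 al1] w0 wu.
pose P S := proj_col (subX X S).
(* Models of weight zero get the identity: their Gram matrix may be singular, and the Gaussian
   formula wants a positive definite matrix at every index. *)
pose A S := if w S == 0 then 1%:M else s2^-1 *: (1%:M - al *: P S).
pose m S := (1 - al) *: mu + al *: (P S *m mu).
pose K := (Num.sqrt ((2 * pi) ^+ n * s2 ^+ n)).
have K2 : 0 < (2 * pi : R) ^+ n by rewrite exprn_gt0 // mulr_gt0 // pi_gt0.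
have K0 : 0 < K by rewrite sqrtr_gt0 mulr_gt0 // exprn_gt0.
have pA S : posdef (A S).
  rewrite /A; case: eqVneq => [_|wS]; first exact: posdef1.
  apply: posdefZ; first by rewrite invr_gt0.
  by apply: posdef_1Bproj => //;
    [exact: proj_col_sym|exact: proj_col_idem (wu _ wS)].
have -> : (\sum_S w S * (Num.sqrt (1 - al))^-1 ^+ #|S|)%:E =
    lebn (fun y => (\sum_S w S / K * expR (- qform (A S) (y - m S) / 2))%:E).
  rewrite lebn_gauss //; last by move=> S; rewrite divr_ge0 // ltW.
  congr _%:E; apply: eq_bigr => S _.
  have [->|wS] := eqVneq (w S) 0; first by rewrite !mul0r.
  rewrite -mulrA; congr (_ * _); rewrite /A (negbTE wS) detZ.
  rewrite det_1Bproj_col ?wu //.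
  have -> : (2 * pi) ^+ n / (s2^-1 ^+ n * (1 - al) ^+ #|S|) =
      (2 * pi) ^+ n * s2 ^+ n * ((1 - al)^-1 ^+ #|S|).
    by rewrite invfM -exprVn invrK -exprVn mulrA.
  rewrite sqrtrM ?mulr_ge0 ?exprn_ge0 ?ltW // ?mulr_gt0 ?pi_gt0 // -/K.
  rewrite mulKf ?gt_eqF // sqrtr_exp ?sqrtrV ?invr_ge0 ?subr_ge0 ?ltW //.
apply: le_lebn => y.
  rewrite lee_fin sumr_ge0 // => S _.
  by rewrite !mulr_ge0 ?expR_ge0 ?gauss_dens_ge0.
rewrite lee_fin; apply: ler_sum => S _.
have [->|wS] := eqVneq (w S) 0; first by rewrite !mul0r.
rewrite -mulrA; apply: ler_wpM2l; first exact: w0.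
rewrite gauss_dens_iso // -/K -mulrA; apply: ler_wpM2l.
  by rewrite invr_ge0 ltW.
rewrite -expRD ler_expR /A (negbTE wS) qformZ.
have := @qform_1Bproj_le R n (P S) al mu y _ (proj_col_sym _)
  (proj_col_idem (wu _ wS)).
rewrite (ltW al0) (ltW al1) -/(m S) -/(P S) => /(_ isT).
move: (qform _ _) (sqnorm _) (sqnorm _) => q a b.
rewrite -(ler_pM2l (_ : 0 < s2^-1 / 2)) ?divr_gt0 ?invr_gt0 // => h.
rewrite -subr_ge0; move: h; rewrite -subr_ge0.
set u := (X in 0 <= X -> _); set v := (X in _ -> 0 <= X).
by have -> : v = u by rewrite /u /v; field; rewrite gt_eqF.
Qed.

End Gauss.

(** * Evidence of a model *)

Section Model.
Context {R : realType}.

Lemma mxpowr_spec s (A : 'M[R]_s) t : (exists UD, spec_dec A UD) ->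
  exists2 UD, spec_dec A UD & mxpowr A t = specmx UD.1 (\row_i (UD.2 0 i `^ t)).
Proof.
rewrite /mxpowr; case: pselect => // H _.
by exists (projT1 (cid H)) => //; exact: projT2.
Qed.

Lemma mxpowr_out s (A : 'M[R]_s) t :
  ~ (exists UD, spec_dec A UD) -> mxpowr A t = 0.
Proof. by rewrite /mxpowr; case: pselect. Qed.

Lemma spec_dec_unit s (A : 'M[R]_s) : (exists UD, spec_dec A UD) -> A \in unitmx.
Proof. by move=> [UD [UU d0 ->]]; apply: posdef_unit; exact: specmx_posdef. Qed.

Lemma sqnorm_orth s (U : 'M[R]_s) v : U^T *m U = 1%:M ->
  sqnorm (U^T *m v) = sqnorm v.
Proof.
move=> UU; rewrite -qform_mulmx trmxK (mulmx1C UU).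
by rewrite /qform mulmx1 -sqnormE.
Qed.

Variables (n p : nat) (X : 'M[R]_(n, p)).
Variables (s2 lam g al phi : R).
Hypotheses (s20 : 0 < s2) (g0 : 0 < g) (al01 : 0 < al < 1).
Implicit Type S : {set 'I_p}.
Local Notation PB S := (@prior_beta R n p X s2 lam g phi S).
Local Notation G := (gram X).

(** The covariance is a multiple of a power of the Gram matrix, so one orthogonal [U] diagonalises
    both. A nonempty [S] makes the two sums in [k] positive. *)
Lemma prior_cov S : (0 < #|S|)%N -> (exists UD, spec_dec (G S) UD) ->
  exists (U : 'M[R]_#|S|) (d : 'rV[R]_#|S|) (k : R),
  [/\ U^T *m U = 1%:M, forall i, 0 < d 0 i, G S = specmx U d,
      k = (\sum_i (d 0 i)^-1) / (\sum_i d 0 i `^ lam) /\ 0 < k &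
      (s2 * g * kS X lam S) *: mxpowr (G S) lam =
        specmx U (\row_i (s2 * g * k * d 0 i `^ lam))].
Proof.
move=> S0 /(mxpowr_spec lam)[[U d]] [/= UU d0 GE] VE.
pose k := (\sum_i (d 0 i)^-1) / (\sum_i d 0 i `^ lam).
have kE : kS X lam S = k.
  rewrite /kS VE [gram X S]GE -/(specmx U d) specmx_inv //; last first.
    by move=> i; rewrite gt_eqF.
  rewrite !specmx_tr //; congr (_ / _); apply: eq_bigr => i _; by rewrite mxE.
exists U, d, k; split => //; first split => //.
  have pos (F : 'I_#|S| -> R) : (forall i, 0 < F i) -> 0 < \sum_i F i.
    move=> F0; rewrite (bigD1 (Ordinal S0)) //= ltr_pwDl //.
    by rewrite sumr_ge0 // => i _; rewrite ltW.
  by rewrite divr_gt0 //; apply: pos => i; rewrite ?invr_gt0 ?powR_gt0.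
rewrite kE VE specmxZ; congr specmx; apply/rowP => i; by rewrite !mxE.
Qed.

(** Here [mxpowr] defaults to 0, so the determinant vanishes and the normalising factor is the
    inverse of 0, that is 0. For the empty model the determinant would be 1. *)
Lemma prior_beta_out S Y b : (0 < #|S|)%N ->
  ~ (exists UD, spec_dec (G S) UD) -> PB S Y b = 0.
Proof.
move=> S0 H; rewrite /prior_beta mxpowr_out // scaler0 /gauss_dens.
have -> : \det (0 : 'M[R]_#|S|) = 0.
  by move: S0; case: #|S| => // k _; exact: det0.
by rewrite mulr0 sqrtr0 invr0 !mul0r.
Qed.

Lemma lebn_prior_le S Y e : (0 < #|S|)%N -> 0 <= e ->
  (lebn (fun b => (e * PB S Y b)%:E) <=
   (if `[< exists UD, spec_dec (G S) UD >] then e else 0)%:E)%E.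
Proof.
move=> S0 e0; case: asboolP => [H|H].
  have [U [d [k [UU d0 _ [_ k0] VE]]]] := prior_cov S0 H.
  rewrite /prior_beta VE lebn_gauss_dens //; apply: specmx_posdef => // i.
  by rewrite mxE !mulr_gt0 // powR_gt0.
(* The zero integrand is written as a null multiple of a Gaussian density, so that its iterated
   integral follows from the Gaussian formula. *)
have E b : e * PB S Y b = 0 * gauss_dens 0 1%:M b.
  by rewrite prior_beta_out // mulr0 mul0r.
under eq_fun do rewrite E.
by rewrite lebn_gauss_dens //; exact: posdef1.
Qed.

Lemma LR_powR (Y : 'cV[R]_n) (b b0 : 'cV[R]_p) :
  LR X s2 Y b b0 `^ al =
  expR (- (al * (sqnorm (Y - X *m b) - sqnorm (Y - X *m b0))) / (2 * s2)).
Proof.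
rewrite /LR /Lik -mulf_div divff ?mul1r; last first.
  by rewrite invr_neq0 // gt_eqF // powR_gt0 // !mulr_gt0 // pi_gt0.
rewrite -expRN -expRD -expRM; congr expR; by field; rewrite gt_eqF.
Qed.

Lemma fillS_mul S (b : 'cV[R]_#|S|) : X *m fillS b = subX X S *m b.
Proof. by rewrite /fillS /subX mulmxA. Qed.

Lemma supp_fillS S (b : 'cV[R]_#|S|) : (#|supp (fillS b)| <= #|S|)%N.
Proof.
apply/subset_leq_card/fintype.subsetP => i; rewrite inE; apply: contraNT => iS.
rewrite mxE big1 // => j _; rewrite mxE.
by case: eqP => [E|]; rewrite ?mul0r //; move: iS; rewrite E enum_valP.
Qed.

Lemma supp_fillSK (b : 'cV[R]_p) :
  exists2 b0 : 'cV[R]_#|supp b|, b = fillS b0 & sqnorm b0 = sqnorm b.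
Proof.
exists (\col_j b (enum_val j) 0).
  apply/colP => i; rewrite mxE.
  under eq_bigr do rewrite !mxE.
  rewrite -(big_enum_val (fun k => (i == k)%:R * b k 0)) /=.
  have [iS|iS] := boolP (i \in supp b).
    rewrite (bigD1 i) //= eqxx mul1r big1 ?addr0 // => k /andP[_ ki].
    by rewrite eq_sym (negbTE ki) mul0r.
  rewrite big1 => [|k kS].
    by move: iS; rewrite inE negbK => /eqP.
  by case: eqP => [E|]; rewrite ?mul0r //; move: iS; rewrite E kS.
rewrite /sqnorm; under eq_bigr do rewrite mxE.
rewrite -(big_enum_val (fun k => b k 0 ^+ 2)) /= big_mkcond /=.
by apply: eq_bigr => i _; rewrite inE; case: eqP => [->|]; rewrite ?expr0n.
Qed.

(** Both residuals contain |y - P y|^2, and the one at [b0] also |P (y - mu)|^2. Writing P y - Z b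
    as (1 - phi) P y - e, and P y as P (y - mu) + mu, leaves a noise term 4 (1 - phi)^2 |P (y -
    mu)|^2 that this surplus absorbs. Thus [y] survives only in the centre of the last square. *)
Lemma residual_upper s (Z : 'M[R]_(n, s)) (b0 b : 'cV[R]_s) (y : 'cV[R]_n) :
  Z^T *m Z \in unitmx -> 4 * (1 - phi) ^+ 2 <= 1 ->
  sqnorm (y - Z *m b) - sqnorm (y - Z *m b0) <=
  4 * (1 - phi) ^+ 2 * sqnorm (Z *m b0) +
  2 * sqnorm (Z *m (b - phi *: (invmx (Z^T *m Z) *m Z^T *m y))).
Proof.
move=> uG dl; set mu := Z *m b0; set P := proj_col Z.
have Zbh : Z *m (invmx (Z^T *m Z) *m Z^T *m y) = P *m y by rewrite !mulmxA.
rewrite residual_split // -/P mulmxBr -scalemxAr Zbh.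
rewrite (pythagoras (y - mu) (proj_col_sym Z) (proj_col_idem uG)) -/P.
have -> : y - mu - P *m (y - mu) = y - P *m y.
  by rewrite mulmxBr [P *m mu]mulmxA proj_colK // opprB addrA subrK.
set e := Z *m b - _.
have h1 : sqnorm (P *m y - Z *m b) <= 2 * ((1 - phi) ^+ 2 * sqnorm (P *m y)) + 2 * sqnorm e.
  rewrite -sqnormZ (_ : P *m y - Z *m b = (1 - phi) *: (P *m y) - e) ?sqnormB_le //.
  by rewrite /e scalerBl scale1r opprB addrA subrK.
have h2 : sqnorm (P *m y) <= 2 * sqnorm (P *m (y - mu)) + 2 * sqnorm mu.
  rewrite -(sqnormN mu).
  rewrite [X in sqnorm X <= _](_ : _ = P *m (y - mu) - (- mu)) ?sqnormB_le //.
  by rewrite mulmxBr [P *m mu]mulmxA proj_colK // opprK subrK.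
have := sqr_ge0 (1 - phi); have := sqnorm_ge0 (P *m (y - mu)).
move: h1 h2 dl; move: (sqnorm (P *m (y - mu))) (sqnorm (P *m y)) (sqnorm mu).
move: ((1 - phi) ^+ 2) (sqnorm e) (sqnorm (P *m y - Z *m b)).
move: (sqnorm (y - P *m y)) => z de se x pe py m h1 h2 hd pe0 d0.
have h3 : de * py <= de * (2 * pe + 2 * m) by apply: ler_wpM2l.
have h4 : 4 * de * pe <= 1 * pe by apply: ler_wpM2r.
nra.
Qed.

(** By [residual_upper] the integrand dominates a Gaussian exponential with the centre of the prior;
    the data move only this centre, so the integral is free of [Y]. The last hypothesis ranges over
    all decompositions because the one behind [mxpowr] is picked by choice. *)
Lemma lebn_evidence_ge S (b0 : 'cV[R]_#|S|) Y q : (0 < #|S|)%N ->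
  (exists UD, spec_dec (G S) UD) ->
  4 * (1 - phi) ^+ 2 <= 1 ->
  (forall UD, spec_dec (G S) UD -> forall i,
    al * g * ((\sum_j (UD.2 0 j)^-1) / (\sum_j UD.2 0 j `^ lam)) *
      (UD.2 0 i * UD.2 0 i `^ lam) <= q) ->
  ((expR (- (2 * al * (1 - phi) ^+ 2 * sqnorm (subX X S *m b0)) / s2) *
    (Num.sqrt (1 + 2 * q))^-1 ^+ #|S|)%:E <=
   lebn (fun b => (LR X s2 Y (fillS b) (fillS b0) `^ al * PB S Y b)%:E))%E.
Proof.
move=> S0 H dl hq; have [al0 al1] := andP al01.
have uG : (subX X S)^T *m subX X S \in unitmx by exact: spec_dec_unit.
have [U [d [k [UU d0 GE [kE k0] VE]]]] := prior_cov S0 H.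
have {}hq i : al * g * k * (d 0 i * d 0 i `^ lam) <= q.
  by rewrite kE; apply: (hq (U, d)).
pose v : 'rV[R]_#|S| := \row_i (s2 * g * k * d 0 i `^ lam).
have v0 i : 0 < v 0 i by rewrite mxE !mulr_gt0 // powR_gt0.
(* Prior precision plus tempered information in the common eigenbasis; the 2 is the one lost in
   [sqnormB_le]. Then v_i h_i = 1 + 2 al g k d_i d_i^lam. *)
pose h : 'rV[R]_#|S| := \row_i ((v 0 i)^-1 + 2 * al / s2 * d 0 i).
have h0 i : 0 < h 0 i by rewrite mxE addr_gt0 ?invr_gt0 // !mulr_gt0 ?invr_gt0.
pose K := Num.sqrt ((2 * pi) ^+ #|S| * \prod_i v 0 i).
have pi2 : 0 < (2 * pi : R) ^+ #|S| by rewrite exprn_gt0 // mulr_gt0 // pi_gt0.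
have pv : 0 < \prod_i v 0 i by apply: prodr_gt0.
have ph : 0 < \prod_i h 0 i by apply: prodr_gt0.
have K0 : 0 < K by rewrite sqrtr_gt0 mulr_gt0.
set E0 := expR _; pose m := phi *: betahat X S Y.
apply: (@le_trans _ _ (lebn (fun b => (\sum_(i : unit)
    E0 / K * expR (- qform (specmx U h) (b - m) / 2))%:E))).
  rewrite lebn_gauss; last 2 first.
  - by move=> _; rewrite divr_ge0 ?expR_ge0 // ltW.
  - by move=> _; exact: specmx_posdef.
  rewrite big_const card_unit /= addr0 lee_fin -mulrA.
  apply: ler_wpM2l; first exact: expR_ge0.
  have KV : K^-1 = Num.sqrt ((2 * pi) ^+ #|S| * \prod_i v 0 i)^-1.
    by rewrite sqrtrV // mulr_ge0 // ltW.
  rewrite specmx_det // KV -sqrtrM; last first.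
    by rewrite invr_ge0 mulr_ge0 // ltW.
  have -> : ((2 * pi) ^+ #|S| * \prod_i v 0 i)^-1 * ((2 * pi) ^+ #|S| / \prod_i h 0 i) =
      (\prod_i (v 0 i * h 0 i))^-1.
    by rewrite big_split /=; field; rewrite !gt_eqF.
  have vh i : v 0 i * h 0 i <= 1 + 2 * q.
    rewrite [h 0 i]mxE mulrDr divff ?gt_eqF // lerD2l.
    have := hq i; rewrite mxE; set w := (_ * _ * _ * _) => hw.
    rewrite (_ : _ * _ = 2 * w); last by rewrite /w; field; rewrite gt_eqF.
    by rewrite ler_pM2l.
  have q0 : 0 <= 1 + 2 * q.
    by apply: le_trans (vh (Ordinal S0)); rewrite mulr_ge0 // ltW.
  rewrite exprVn -sqrtr_exp // -sqrtrV ?exprn_ge0 // ler_sqrt; last first.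
    by rewrite invr_ge0 prodr_ge0 // => i _; rewrite mulr_ge0 // ltW.
  rewrite lef_pV2; last 2 first.
  - rewrite posrE exprn_gt0 //; apply: lt_le_trans (vh (Ordinal S0)).
    by rewrite mulr_gt0.
  - by rewrite posrE prodr_gt0 // => i _; rewrite mulr_gt0.
  have -> : (1 + 2 * q) ^+ #|S| = \prod_(i < #|S|) (1 + 2 * q).
    by rewrite prodr_const card_ord.
  by apply: ler_prod => i _; rewrite vh mulr_ge0 // ltW.
apply: le_lebn => b; rewrite big_const card_unit /= addr0.
  by rewrite lee_fin mulr_ge0 ?expR_ge0 // divr_ge0 ?expR_ge0 // ltW.
rewrite lee_fin LR_powR !fillS_mul /prior_beta VE /gauss_dens -/v -/m.
rewrite specmx_det // -/K specmx_inv //; last by move=> i; rewrite gt_eqF.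
rewrite mulrA mulrAC [X in _ <= X]mulrAC; apply: ler_wpM2r.
  by rewrite invr_ge0 ltW.
rewrite /E0 -!expRD ler_expR.
have -> : qform (specmx U h) (b - m) =
    qform (specmx U (\row_i (v 0 i)^-1)) (b - m) +
    2 * al / s2 * sqnorm (subX X S *m (b - m)).
  rewrite -qform_mulmx [_^T *m _]GE !specmx_qform // mulr_sumr -big_split /=.
  by apply: eq_bigr => i _; rewrite !mxE; ring.
have := residual_upper b0 b Y uG dl; rewrite -/m.
rewrite -/(qform _ (b - m)).
move: (qform _ _) (sqnorm _) (sqnorm _) (sqnorm _) (sqnorm _) => A1 A2 A3 A4 A5.
rewrite -(ler_pM2l (_ : 0 < al / (2 * s2))) ?divr_gt0 ?mulr_gt0 //.
rewrite -subr_ge0 => H1; rewrite -subr_ge0; move: H1.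
set u := (X in 0 <= X -> _); set w := (X in _ -> 0 <= X).
by have -> : w = u by rewrite /u /w; field; rewrite gt_eqF.
Qed.

End Model.

(** * Posterior mass of large models at fixed n *)

Section Bound.
Context {R : realType}.
Variables (n p : nat) (X : 'M[R]_(n, p)).
Variables (s2 lam g al a c C r phi : R).
Hypotheses (s20 : 0 < s2) (g0 : 0 < g) (al01 : 0 < al < 1).
Implicit Type S : {set 'I_p}.
Local Notation G := (gram X).
Local Notation pS := (piS X lam a c C r).

Lemma fsize_ge0 k : 0 <= fsize X a c k.
Proof.
rewrite /fsize; case: ifP => // _.
rewrite divr_ge0 ?mulr_ge0 ?powR_ge0 // sumr_ge0 // => i _.
by rewrite mulr_ge0 ?powR_ge0.
Qed.

Lemma wS_ge0 S : 0 <= wS X lam C r S.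
Proof. by rewrite mulr_ge0 ?powR_ge0 //; case: ifP. Qed.

Lemma piS_ge0 S : 0 <= pS S.
Proof.
rewrite mulr_ge0 ?fsize_ge0 // divr_ge0 ?wS_ge0 // sumr_ge0 // => S' _.
exact: wS_ge0.
Qed.

(** Only an inequality: the weights of size [k] may all vanish, and then each quotient is 0. *)
Lemma sum_piS k : \sum_(S : {set 'I_p} | #|S| == k) pS S <= fsize X a c k.
Proof.
rewrite (_ : \sum_(_ | _) _ =
    fsize X a c k * ((\sum_(S : {set 'I_p} | #|S| == k) wS X lam C r S) /
      \sum_(S : {set 'I_p} | #|S| == k) wS X lam C r S)); last first.
  rewrite mulr_suml mulr_sumr; apply: eq_bigr => S /eqP Sk.
  by rewrite /piS /piS_cond Sk.
set T := \sum_(_ | _) wS _ _ _ _ _.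
have [->|T0] := eqVneq T 0; first by rewrite mul0r mulr0 fsize_ge0.
by rewrite divff // mulr1.
Qed.

(** Prior mass of the models that can contribute to [Uset]: smaller ones produce too few nonzero
    entries, and for a nonempty model without positive definite Gram matrix the prior density is 0
    by convention. *)
Definition heavy (t : R) S : R :=
  if (t <= #|S|%:R) && `[< exists UD, spec_dec (G S) UD >] then pS S else 0.

Lemma heavy_ge0 t S : 0 <= heavy t S.
Proof. by rewrite /heavy; case: ifP => // _; exact: piS_ge0. Qed.

Lemma Nn_Uset_le bstar Y rho k : 0 < rho -> (0 < k)%N ->
  (Nn X s2 lam g al a c C r phi bstar Y (@Uset R p rho k) <=
   (\sum_S heavy (rho * k%:R) S *
     expR (- (al * (sqnorm (Y - proj_col (subX X S) *m Y) -
       sqnorm (Y - X *m bstar))) / (2 * s2)))%:E)%E.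
Proof.
move=> rho0 k0; have [al0 al1] := andP al01.
rewrite /Nn -sumEFin; apply: lee_sum => S _.
set E := expR _; rewrite /heavy.
have [big|small] := leP (rho * k%:R) #|S|%:R; last first.
  rewrite mul0r (_ : lebn _ = 0%E) ?mule0 //.
  rewrite (_ : (fun _ => _) = fun b => (0 * gauss_dens 0 1%:M b)%:E); last first.
    apply/funext => b; case: asboolP => [|_]; last by rewrite mul0r.
    rewrite /Uset /= => H; have := lt_le_trans small H.
    by rewrite ltr_nat ltnNge supp_fillS.
  by rewrite lebn_gauss_dens //; exact: posdef1.
have S0 : (0 < #|S|)%N.
  rewrite -(ltr_nat R); apply: lt_le_trans big.
  by rewrite mulr_gt0 // ltr0n.
rewrite (_ : (_ * E)%:E = (pS S)%:E *
    (if `[< exists UD, spec_dec (G S) UD >] then E else 0)%:E)%E; last first.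
  by rewrite -EFinM /=; case: asboolP => _; rewrite ?mul0r ?mulr0.
apply: lee_wpmul2l; first by rewrite lee_fin piS_ge0.
pose PB b := @prior_beta R n p X s2 lam g phi S Y b.
have PB0 b : 0 <= PB b by exact: gauss_dens_ge0.
apply: le_trans _ (@lebn_prior_le R n p X s2 lam g phi s20 g0 S Y E S0 (expR_ge0 _)).
apply: le_lebn => b; first by case: ifP => // _; rewrite lee_fin mulr_ge0 ?powR_ge0 //.
rewrite -/(PB b); case: ifP => _; last by rewrite lee_fin mulr_ge0 // expR_ge0.
rewrite lee_fin.
have [H|H] := pselect (exists UD, spec_dec (G S) UD); last first.
  by rewrite /PB prior_beta_out // !mulr0.
apply: ler_wpM2r => //; rewrite LR_powR // ler_expR fillS_mul.
rewrite residual_split; last exact: spec_dec_unit.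
rewrite ler_pM2r ?invr_gt0 ?mulr_gt0 // lerN2 ler_pM2l //.
by rewrite lerB // lerDl sqnorm_ge0.
Qed.

Lemma Dn_ge bstar Y S (dlow : R) :
  (dlow%:E <= lebn (fun b => (LR X s2 Y (fillS b) bstar `^ al *
      @prior_beta R n p X s2 lam g phi S Y b)%:E))%E ->
  ((pS S * dlow)%:E <= Dn X s2 lam g al a c C r phi bstar Y)%E.
Proof.
move=> H; rewrite /Dn /Nn (bigD1 S) //=.
have f0 S' : (0 <= (pS S')%:E * lebn (fun b : 'cV[R]_#|S'| =>
   if `[< [set: 'cV[R]_p] (fillS b) >]
   then (LR X s2 Y (fillS b) bstar `^ al *
      @prior_beta R n p X s2 lam g phi S' Y b)%:E
   else 0))%E.
  rewrite mule_ge0 ?lee_fin ?piS_ge0 //; apply: lebn_ge0 => b.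
  by case: ifP => // _; rewrite lee_fin mulr_ge0 ?powR_ge0 ?gauss_dens_ge0.
rewrite -[X in (X <= _)%E]adde0; apply: leeD; last by apply: sume_ge0.
rewrite EFinM; apply: lee_wpmul2l; first by rewrite lee_fin piS_ge0.
apply: le_trans H _; apply: le_lebn => b.
  by rewrite lee_fin mulr_ge0 ?powR_ge0 ?gauss_dens_ge0.
by rewrite asboolT.
Qed.

(** [y] may be infinite; then [fine y] is 0 and so is the quotient, within the bound. *)
Lemma fine_div_le (x y : \bar R) (u v : R) : (0 <= x)%E -> (x <= u%:E)%E ->
  0 < v -> (v%:E <= y)%E -> fine x / fine y <= u / v.
Proof.
move=> x0 xu v0 vy.
have u0 : 0 <= u by rewrite -lee_fin (le_trans x0).
case: x x0 xu => [x| |] //=; rewrite ?lee_fin => x0 xu.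
case: y vy => [y| |] //=; rewrite ?lee_fin => vy.
  by rewrite ler_pM ?invr_ge0 ?lef_pV2 ?posrE ?(lt_le_trans v0) // ltW // (lt_le_trans v0).
by rewrite invr0 mulr0 divr_ge0 // ltW.
Qed.

Lemma Nn_ge0 bstar Y A : (0 <= Nn X s2 lam g al a c C r phi bstar Y A)%E.
Proof.
apply: sume_ge0 => S _; rewrite mule_ge0 ?lee_fin ?piS_ge0 //.
apply: lebn_ge0 => b.
by case: ifP => // _; rewrite lee_fin mulr_ge0 ?powR_ge0 ?gauss_dens_ge0.
Qed.

Lemma Post_ge0 bstar Y A : 0 <= Post X s2 lam g al a c C r phi bstar Y A.
Proof. by rewrite divr_ge0 // fine_ge0 // Nn_ge0. Qed.

Lemma EPost_ge0 bstar A : (0 <= EPost X s2 lam g al a c C r phi bstar A)%E.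
Proof.
apply: lebn_ge0 => Y; rewrite lee_fin mulr_ge0 ?gauss_dens_ge0 //.
exact: Post_ge0.
Qed.

(** The lower bound on [Dn] does not depend on [Y], so it is absorbed in the weights of the mixture
    before integrating. [M] bounds the signal |X_S b|^2 by M |b|^2. *)
Lemma EPost_le (bstar : 'cV[R]_p) rho M q :
  let S := supp bstar in
  0 < rho -> (0 < #|S|)%N -> 0 < pS S ->
  (exists UD, spec_dec (G S) UD) ->
  4 * (1 - phi) ^+ 2 <= 1 -> 0 <= q ->
  (forall UD, spec_dec (G S) UD -> forall i, UD.2 0 i <= M) ->
  (forall UD, spec_dec (G S) UD -> forall i,
    al * g * ((\sum_j (UD.2 0 j)^-1) / (\sum_j UD.2 0 j `^ lam)) *
      (UD.2 0 i * UD.2 0 i `^ lam) <= q) ->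
  (EPost X s2 lam g al a c C r phi bstar (@Uset R p rho #|S|) <=
   (\sum_S' heavy (rho * #|S|%:R) S' * (Num.sqrt (1 - al))^-1 ^+ #|S'| /
     (pS S * (expR (- (2 * al * (1 - phi) ^+ 2 * (M * sqnorm bstar)) / s2) *
       (Num.sqrt (1 + 2 * q))^-1 ^+ #|S|)))%:E)%E.
Proof.
move=> S rho0 S0 pS0 H dl q0 hM hq; have [al0 al1] := andP al01.
set dlow := expR _ * _.
have dlow0 : 0 < dlow.
  rewrite mulr_gt0 ?expR_gt0 // exprn_gt0 // invr_gt0 sqrtr_gt0.
  by rewrite ltr_pwDl // mulr_ge0.
have D0 : 0 < pS S * dlow by rewrite mulr_gt0.
have Dge Y : ((pS S * dlow)%:E <= Dn X s2 lam g al a c C r phi bstar Y)%E.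
  apply: Dn_ge; have [b0 bE nb] := supp_fillSK bstar.
  rewrite [in X in (_ <= X)%E]bE.
  apply: le_trans _ (lebn_evidence_ge s20 g0 al01 b0 Y S0 H dl hq).
  rewrite lee_fin ler_wpM2r //.
  rewrite ler_expR ler_pM2r ?invr_gt0 // lerN2 ler_wpM2l //.
    by rewrite mulr_ge0 ?sqr_ge0 // mulr_ge0 // ltW.
  have [[U d] UD] := H; have := hM _ UD; case: (UD) => /= UU d0 GE hd.
  rewrite -qform_mulmx [_^T *m _]GE -/(specmx U d) specmx_qform // -nb.
  rewrite -(sqnorm_orth b0 UU) /sqnorm mulr_sumr.
  by apply: ler_sum => i _; rewrite ler_wpM2r ?sqr_ge0.
rewrite (_ : \sum_S' _ = \sum_S' (heavy (rho * #|S|%:R) S' / (pS S * dlow)) *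
    (Num.sqrt (1 - al))^-1 ^+ #|S'|); last first.
  by apply: eq_bigr => S' _; rewrite mulrAC.
apply: le_trans _ (lebn_lik_ratio (X := X) (X *m bstar) s20 al01 _ _); last 2 first.
- by move=> S'; rewrite divr_ge0 ?heavy_ge0 // ltW.
- move=> S'; rewrite mulf_eq0 negb_or => /andP[+ _].
  rewrite /heavy; case: ifP => [/andP[_ /asboolP h] _|]; last by rewrite eqxx.
  exact: spec_dec_unit.
apply: le_lebn => Y.
  by rewrite lee_fin mulr_ge0 ?gauss_dens_ge0 ?Post_ge0.
rewrite lee_fin.
apply: (@le_trans _ _ (gauss_dens (X *m bstar) s2%:M Y * ((\sum_S' heavy (rho * #|S|%:R) S' *
     expR (- (al * (sqnorm (Y - proj_col (subX X S') *m Y) -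
       sqnorm (Y - X *m bstar))) / (2 * s2))) / (pS S * dlow)))).
  apply: ler_wpM2l; first exact: gauss_dens_ge0.
  by apply: fine_div_le => //; [exact: Nn_ge0|exact: Nn_Uset_le].
rewrite mulr_suml mulr_sumr; apply: ler_sum => S' _.
by rewrite le_eqVlt; apply/orP; left; apply/eqP; ring.
Qed.

End Bound.

(** * Prior mass of the true model *)

Lemma leq_bin_expn m k : ('C(m, k) <= m ^ k)%N.
Proof.
apply: leq_trans (_ : _ <= m ^_ k)%N _.
  by rewrite -bin_ffact leq_pmulr // fact_gt0.
rewrite ffact_prod (_ : m ^ k = \prod_(i < k) m)%N; last first.
  by rewrite prod_nat_const card_ord.
by apply: leq_prod => i _; exact: leq_subr.
Qed.

(** * Eigenvalue bounds for Gram matrices *)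

Section Eigen.
Context {R : realType}.

Lemma specmx_eigenvalue s (U : 'M[R]_s) (d : 'rV[R]_s) i :
  U^T *m U = 1%:M -> eigenvalue (specmx U d) (d 0 i).
Proof.
move=> UU; apply/eigenvalueP; exists (row i U^T).
  rewrite -row_mul /specmx !mulmxA UU mul1mx row_mul row_diag_mx.
  by rewrite -scalemxAl -rowE.
apply/negP => /eqP r0; have : row i (U^T *m U) = 0 by rewrite row_mul r0 mul0mx.
by rewrite UU => /rowP/(_ i)/eqP; rewrite !mxE eqxx oner_eq0.
Qed.

Lemma eigenvalue_specmx s (U : 'M[R]_s) (d : 'rV[R]_s) x : U^T *m U = 1%:M ->
  eigenvalue (specmx U d) x -> exists i, x = d 0 i.
Proof.
move=> UU /eigenvalueP[v vA v0].
have vU : v *m U *m diag_mx d = x *: (v *m U).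
  by rewrite scalemxAl -vA /specmx -!mulmxA UU mulmx1.
have [i wi] : exists i, (v *m U) 0 i != 0.
  apply/existsP; rewrite -negb_forall; apply: contra v0 => /forallP w0.
  apply/eqP; rewrite -[v]mulmx1 -(mulmx1C UU) mulmxA.
  rewrite (_ : v *m U = 0) ?mul0mx //; apply/rowP => i.
  by rewrite [RHS]mxE; apply/eqP; exact: w0.
exists i; have /rowP/(_ i) := vU; rewrite mul_mx_diag mxE [in RHS]mxE.
by rewrite mulrC => /(mulIf wi).
Qed.

(** Eigenvalues are among the diagonal entries of a spectral decomposition, hence bounded; this is
    what makes [inf] and [sup] genuine bounds. *)
Lemma lam_min_max s (A : 'M[R]_s) x : A^T = A -> eigenvalue A x ->
  lam_min A <= x <= lam_max A.
Proof.
move=> sA eA; have [U [d [UU AE]]] := real_spectral sA.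
have eigb y : eigs A y -> `|y| <= \sum_i `|d 0 i|.
  rewrite /eigs /= AE => /(eigenvalue_specmx UU)[i ->].
  by rewrite (bigD1 i) //= lerDl sumr_ge0.
apply/andP; split.
  apply: ge_inf => //; exists (- \sum_i `|d 0 i|) => y /eigb.
  by rewrite ler_norml => /andP[].
apply: ub_le_sup => //; exists (\sum_i `|d 0 i|) => y /eigb.
by rewrite ler_norml => /andP[].
Qed.

Lemma eigenvalueZ s (A : 'M[R]_s) k x :
  eigenvalue A x -> eigenvalue (k *: A) (k * x).
Proof.
move=> /eigenvalueP[v vA v0]; apply/eigenvalueP; exists v => //.
by rewrite -scalemxAr vA scalerA.
Qed.

Lemma gram_sym n p (X : 'M[R]_(n, p)) S : (gram X S)^T = gram X S.
Proof. by rewrite /gram trmx_mul trmxK. Qed.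

(** There are finitely many configurations, so a sum of absolute values bounds the set whose [inf]
    or [sup] is taken. *)
Lemma ell_uu_bounds n p (X : 'M[R]_(n, p)) (S : {set 'I_p}) :
  ell X #|S| <= lam_min (n%:R^-1 *: gram X S) /\
  lam_max (n%:R^-1 *: gram X S) <= uu X #|S|.
Proof.
have bnd (f : {set 'I_p} -> R) (x : R) :
    [set f S' | S' in [set S' : {set 'I_p} | #|S'| = #|S|]] x ->
    `|x| <= \sum_S' `|f S'|.
  by move=> [S' _ <-]; rewrite (bigD1 S') //= lerDl sumr_ge0.
split.
  apply: ge_inf; last by exists S.
  by eexists => x /bnd; rewrite ler_norml => /andP[h _]; exact: h.
apply: ub_le_sup; last by exists S.
by eexists => x /bnd; rewrite ler_norml => /andP[_ h]; exact: h.
Qed.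

Lemma gram_eigenvalue n p (X : 'M[R]_(n, p)) (S : {set 'I_p}) L u x :
  (0 < n)%N -> L < ell X #|S| -> uu X #|S| < u ->
  eigenvalue (gram X S) x -> n%:R * L <= x <= n%:R * u.
Proof.
move=> n0 Ll uU ex; have nR : 0 < n%:R :> R by rewrite ltr0n.
have [h1 h2] := ell_uu_bounds X S.
have : (n%:R^-1 *: gram X S)^T = n%:R^-1 *: gram X S.
  by rewrite trmxZ gram_sym.
move=> /lam_min_max/(_ (eigenvalueZ n%:R^-1 ex)) /andP[h3 h4].
rewrite -!ler_pdivlMl // in h3 *.
rewrite (le_trans (ltW Ll)) ?(le_trans h1) //=.
by rewrite -ler_pdivrMl // (le_trans h4) // (le_trans h2) // ltW.
Qed.

Lemma gram_spec_dec s (A : 'M[R]_s) L : A^T = A -> 0 < L ->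
  (forall x, eigenvalue A x -> L <= x) -> exists UD, spec_dec A UD.
Proof.
move=> sA L0 hL; have [U [d [UU AE]]] := real_spectral sA.
exists (U, d); split => // i; apply: lt_le_trans L0 _; apply: hL.
by rewrite AE; exact: specmx_eigenvalue.
Qed.

Lemma cond_le s (A : 'M[R]_s) L M : A^T = A -> 0 < L -> (0 < s)%N ->
  (forall x, eigenvalue A x -> L <= x <= M) -> (cond A <= (M / L)%:E)%E.
Proof.
move=> sA L0 s0 hLM; have [x0 ex0] := symmetric_eigenvalue s0 sA.
have minL : L <= lam_min A.
  by apply: lb_le_inf; [exists x0|move=> y /hLM/andP[]].
have maxM : lam_max A <= M.
  by apply: ge_sup; [exists x0|move=> y /hLM/andP[]].
have min0 := lt_le_trans L0 minL.
rewrite /cond gtn_eqF // min0 lee_fin ler_pM //.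
- apply: le_trans (_ : x0 <= _); last by have /andP[] := lam_min_max sA ex0.
  by have /andP[+ _] := hLM _ ex0; apply: le_trans; exact: ltW.
- by rewrite invr_ge0 ltW.
- by rewrite lef_pV2.
Qed.

(** Both x <= (M / L) y and y <= (M / L) x hold; the first serves t >= 0, the second t < 0. *)
Lemma powR_ratio (L M x y t : R) : 0 < L -> L <= x <= M -> L <= y <= M ->
  x `^ t <= (M / L) `^ `|t| * y `^ t.
Proof.
move=> L0 /andP[Lx xM] /andP[Ly yM].
have x0 := lt_le_trans L0 Lx; have y0 := lt_le_trans L0 Ly.
have M0 := lt_le_trans x0 xM.
have le1 z w : L <= w -> z <= M -> z <= M / L * w.
  move=> Lw zM; apply: le_trans zM _.
  by rewrite mulrAC ler_pdivlMr // ler_pM2l.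
have q0 : 0 <= M / L by rewrite divr_ge0 // ltW.
have [t0|t0] := leP 0 t.
  rewrite ger0_norm // -powRM // ?(ltW y0) //; apply: (ge0_ler_powR t0).
  - by rewrite nnegrE ltW.
  - by rewrite nnegrE mulr_ge0 // ltW.
  - exact: le1.
have t1 : 0 <= - t by rewrite oppr_ge0 ltW.
rewrite ltr0_norm // -[in x `^ t](opprK t) -[in y `^ t](opprK t) !(powRN _ (- t)).
rewrite ler_pdivlMr ?powR_gt0 // ler_pdivrMl ?powR_gt0 //.
rewrite mulrC -powRM ?(ltW x0) //; apply: (ge0_ler_powR t1).
- by rewrite nnegrE ltW.
- by rewrite nnegrE mulr_ge0 // ltW.
exact: le1.
Qed.

Lemma powR_ge1 (x t : R) : 1 <= x -> 0 <= t -> 1 <= x `^ t.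
Proof. by move=> x1 t0; rewrite -[leLHS](powRr0 x) ler_powR. Qed.

End Eigen.

(** * Prior probability of a configuration among those of its size *)

Section PriorMass.
Context {R : realType}.
Variables (n p : nat) (X : 'M[R]_(n, p)) (lam C r L M : R).
Variable (S : {set 'I_p}).
Hypotheses (L0 : 0 < L) (S0 : (0 < #|S|)%N).
Hypothesis eigLM : forall S' : {set 'I_p}, #|S'| = #|S| ->
  forall x, eigenvalue (gram X S') x -> L <= x <= M.
Hypothesis condS : M / L < C * p%:R `^ r.

Lemma size_gram_spec (S' : {set 'I_p}) : #|S'| = #|S| ->
  exists UD, spec_dec (gram X S') UD.
Proof.
move=> SS; apply: (gram_spec_dec (gram_sym X S') L0) => x /(eigLM SS).
by case/andP.
Qed.

Lemma spec_dec_bounds (S' : {set 'I_p}) UD i : #|S'| = #|S| ->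
  spec_dec (gram X S') UD -> L <= UD.2 0 i <= M.
Proof.
move=> SS [UU _ GE]; apply: (eigLM SS); rewrite GE; exact: specmx_eigenvalue.
Qed.

Lemma LM_ge1 : 1 <= M / L.
Proof.
have [UD H] := size_gram_spec erefl.
have /andP[h1 h2] := spec_dec_bounds (Ordinal S0) erefl H.
by rewrite ler_pdivlMr // mul1r (le_trans h1).
Qed.

Lemma Ddet_bounds (S' : {set 'I_p}) : #|S'| = #|S| ->
  L ^+ #|S| <= Ddet X S' <= M ^+ #|S|.
Proof.
move=> SS; have [UD H] := size_gram_spec SS.
have hb i := spec_dec_bounds i SS H; have [UU d0 GE] := H.
rewrite /Ddet GE -/(specmx UD.1 UD.2) specmx_det // -SS.
have cst (x : R) : x ^+ #|S'| = \prod_(i < #|S'|) x.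
  by rewrite prodr_const card_ord.
rewrite !cst; apply/andP; split; apply: ler_prod => i _.
  by have /andP[-> _] := hb i; rewrite ltW.
by have /andP[_ ->] := hb i; rewrite ltW.
Qed.

(** The determinants lie between L^s and M^s, and the exponent -lam / (2 s) cancels this power s, so
    the comparison factor is free of s. *)
Lemma wS_le (S' : {set 'I_p}) : #|S'| = #|S| ->
  wS X lam C r S' <= (M / L) `^ (`|lam| / 2) * wS X lam C r S.
Proof.
move=> SS; have sR : 0 < #|S|%:R :> R by rewrite ltr0n.
have condb : (cond (gram X S) < (C * p%:R `^ r)%:E)%E.
  apply: le_lt_trans (cond_le (gram_sym X S) L0 S0 (eigLM erefl)) _.
  by rewrite lte_fin.
rewrite /wS condb mulr1.
apply: (@le_trans _ _ (Ddet X S' `^ (- lam / (2 * #|S'|%:R)))).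
  by case: ifP => _; rewrite ?mulr1 // mulr0 powR_ge0.
rewrite SS.
have := powR_ratio (- lam / (2 * #|S|%:R)) (exprn_gt0 #|S| L0)
  (Ddet_bounds SS) (Ddet_bounds erefl).
rewrite -expr_div_n -powR_mulrn; last by rewrite (le_trans _ LM_ge1).
suff E : #|S|%:R * `|- lam / (2 * #|S|%:R)| = `|lam| / 2 by rewrite -powRrM E.
rewrite normrM normrN normfV (gtr0_norm (_ : 0 < 2 * #|S|%:R)) ?mulr_gt0 //.
by field; rewrite gt_eqF.
Qed.

Lemma wS_gt0 : 0 < wS X lam C r S.
Proof.
have condb : (cond (gram X S) < (C * p%:R `^ r)%:E)%E.
  apply: le_lt_trans (cond_le (gram_sym X S) L0 S0 (eigLM erefl)) _.
  by rewrite lte_fin.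
rewrite /wS condb mulr1 powR_gt0 //; have /andP[+ _] := Ddet_bounds erefl.
by apply: lt_le_trans; rewrite exprn_gt0.
Qed.

(** At most binomial(p, s) <= p^s configurations compete, with comparable weights. This p^-s is the
    origin of the 1 in (a + 1) / rho. *)
Lemma piS_cond_ge :
  ((M / L) `^ (`|lam| / 2) * p%:R ^+ #|S|)^-1 <= piS_cond X lam C r S.
Proof.
have w0 := wS_gt0; have Q0 := lt_le_trans ltr01 LM_ge1.
have K0 : 0 < (M / L) `^ (`|lam| / 2) by rewrite powR_gt0.
have p0 : (0 < p)%N by rewrite (leq_trans S0) // -[p in X in (_ <= X)%N]card_ord max_card.
rewrite /piS_cond; set T := \sum_(_ | _) _.
have T0 : 0 < T.
  rewrite /T (bigD1 S) //= ltr_pwDl // sumr_ge0 // => S' _; exact: wS_ge0.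
have Tle : T <= (M / L) `^ (`|lam| / 2) * p%:R ^+ #|S| * wS X lam C r S.
  apply: le_trans (_ : \sum_(S' : {set 'I_p} | #|S'| == #|S|)
     (M / L) `^ (`|lam| / 2) * wS X lam C r S <= _).
    by apply: ler_sum => S' /eqP SS; exact: wS_le.
  rewrite sumr_const -[leLHS]mulr_natr [leLHS]mulrAC ler_pM2r // ler_pM2l //.
  rewrite -natrX ler_nat; apply: leq_trans (leq_bin_expn p #|S|).
  by have := card_draws 'I_p #|S|; rewrite card_ord cardsE => <-.
rewrite ler_pdivlMr // ler_pdivrMl //.
by rewrite mulr_gt0 // exprn_gt0 // ltr0n.
Qed.

(** The trace ratio makes the prior covariance commensurate with the inverse information: term by
    term, d_i / d_j <= M / L and d_i^lam <= (M / L)^|lam| d_j^lam. *)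
Lemma spec_ratio_le g al UD i : 0 < g -> 0 < al -> spec_dec (gram X S) UD ->
  al * g * ((\sum_j (UD.2 0 j)^-1) / (\sum_j UD.2 0 j `^ lam)) *
    (UD.2 0 i * UD.2 0 i `^ lam) <=
  al * g * (M / L * (M / L) `^ `|lam|).
Proof.
move=> g0 al0 H; have [_ d0 _] := H.
rewrite -[leLHS]mulrA ler_pM2l ?mulr_gt0 //.
set T := \sum_j _ `^ _.
have T0 : 0 < T.
  rewrite /T (bigD1 (Ordinal S0)) //= ltr_pwDl ?powR_gt0 //.
  by rewrite sumr_ge0 // => j _; rewrite powR_ge0.
rewrite mulrAC ler_pdivrMr // mulr_suml mulr_sumr; apply: ler_sum => j _.
have hb k := spec_dec_bounds k erefl H.
rewrite mulrA -mulrA -[leRHS]mulrA mulrA; apply: ler_pM.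
- by rewrite mulr_ge0 ?invr_ge0 // ltW.
- exact: powR_ge0.
- have /andP[Lj _] := hb j; have /andP[_ iM] := hb i.
  by rewrite mulrC ler_pM ?invr_ge0 ?lef_pV2 ?posrE // ltW.
- exact: powR_ratio.
Qed.

End PriorMass.

(** * Convergence *)

Section Rate.
Context {R : realType}.

Lemma geometric_le (x : R) m : 0 <= x -> x <= 1 / 2 ->
  \sum_(k < m) x ^+ k.+1 <= 2 * x.
Proof.
(* The added term carries the induction: for x <= 1/2 it drops by at least x^(m+1) at each step. *)
move=> x0 x1; suff : \sum_(k < m) x ^+ k.+1 + 2 * x * x ^+ m <= 2 * x.
  by apply: le_trans; rewrite lerDl !mulr_ge0 ?exprn_ge0.
elim: m => [|m IH]; first by rewrite big_ord0 add0r expr0 mulr1.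
rewrite big_ord_recr /= -addrA; apply: le_trans IH; rewrite lerD2l.
rewrite exprS; have := exprn_ge0 m x0; move: (x ^+ m) => y y0.
have : x * (x * y) <= 1 / 2 * (x * y) by apply: ler_wpM2r => //; exact: mulr_ge0.
lra.
Qed.

(** The normalising sums cancel, and c^-(k - s) <= max(1, 1/c)^k on either side of c = 1. Sizes
    beyond the rank have mass 0. *)
Lemma fsize_ratio n p (X : 'M[R]_(n, p)) a c k s : 0 < c -> (0 < p)%N ->
  (s <= \rank X)%N -> (s <= k)%N ->
  fsize X a c k <=
  Num.max 1 c^-1 ^+ k * p%:R `^ (a * s%:R - a * k%:R) * fsize X a c s.
Proof.
move=> c0 p0 sr sk; have pR : 0 < p%:R :> R by rewrite ltr0n.
rewrite [X in _ <= _ * X]/fsize sr; set Z := \sum_(_ < _) _.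
have Z0 : 0 < Z.
  rewrite /Z big_ord_recl ltr_pwDl //.
    by rewrite mulr_gt0 // powR_gt0.
  by rewrite sumr_ge0 // => i _; rewrite mulr_ge0 // powR_ge0.
rewrite mulrA; apply: (@le_trans _ _ (fsize_w p a c k / Z)).
  rewrite /fsize; case: ifP => // _.
  by rewrite divr_ge0 ?mulr_ge0 ?powR_ge0 // ltW.
rewrite ler_pM2r ?invr_gt0 // /fsize_w.
rewrite mulrACA -powRD; last by rewrite (gt_eqF pR) implybT.
have -> : a * s%:R - a * k%:R - a * s%:R = - (a * k%:R) by ring.
rewrite ler_pM2r ?powR_gt0 //.
have m1 : 1 <= Num.max 1 c^-1 by rewrite le_max lexx.
have -> : c `^ (- k%:R) = c^-1 `^ (k - s)%:R * c `^ (- s%:R).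
  rewrite -powR_inv1 ?ltW // -powRrM -powRD; last by rewrite (gt_eqF c0) implybT.
  by congr powR; rewrite natrB //; ring.
rewrite ler_pM2r ?powR_gt0 // powR_mulrn ?invr_ge0 ?(ltW c0) //.
apply: le_trans (_ : Num.max 1 c^-1 ^+ (k - s) <= _).
  apply: lerXn2r; rewrite ?nnegrE ?invr_ge0 ?(ltW c0) ?(le_trans ler01 m1) //.
  by rewrite le_max lexx orbT.
by apply: ler_weXn2l => //; exact: leq_subr.
Qed.

(** Every factor of [W] is at least 1, so those occurring to the power [s] may be raised to any k >=
    s. Size k then contributes at most x^k with x = W p^-eta. *)
Lemma EPost_rate n p (X : 'M[R]_(n, p)) s2 lam g al a c C r phi rho kap L u
    (bstar : 'cV[R]_p) :
  let s := #|supp bstar| in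
  let Q := u / L in
  let q := al * g * (Q * Q `^ `|lam|) in
  let eta := a - (a + 1) / rho in
  let W := Num.max 1 c^-1 * Q `^ (`|lam| / 2) * expR kap *
    Num.sqrt (1 + 2 * q) * (Num.sqrt (1 - al))^-1 in
  0 < s2 -> 0 < g -> 0 < al < 1 -> 0 < a -> 0 < c -> 1 < rho -> 0 <= kap ->
  (0 < n)%N -> (0 < s)%N -> (s <= \rank X)%N ->
  0 < L -> L < ell X s -> uu X s < u -> Q < C * p%:R `^ r ->
  4 * (1 - phi) ^+ 2 <= 1 ->
  2 * al * (1 - phi) ^+ 2 * (n%:R * u * sqnorm bstar) / s2 <= kap * s%:R ->
  W * p%:R `^ (- eta) <= 1 / 2 ->
  (EPost X s2 lam g al a c C r phi bstar (Uset rho s) <=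
    (2 * (W * p%:R `^ (- eta)))%:E)%E.
Proof.
move=> s Q q eta W s20 g0 al01 a0 c0 rho1 kap0 n0 s0 sr L0 Ll uU condQ dl hkap hx.
have [al0 al1] := andP al01; pose S := supp bstar.
have nR : 0 < n%:R :> R by rewrite ltr0n.
have p0 : (0 < p)%N.
  by rewrite (leq_trans s0) // -[X in (_ <= X)%N](card_ord p) max_card.
have pR1 : 1 <= p%:R :> R by rewrite ler1n.
have pR : 0 < p%:R :> R by rewrite ltr0n.
have sR : 0 < s%:R :> R by rewrite ltr0n.
have nL : 0 < n%:R * L by rewrite mulr_gt0.
have eigLM (S' : {set 'I_p}) : #|S'| = #|S| ->
    forall x, eigenvalue (gram X S') x -> n%:R * L <= x <= n%:R * u.
  by move=> SS x; apply: gram_eigenvalue => //; rewrite SS.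
have QE : n%:R * u / (n%:R * L) = Q by rewrite /Q; field; rewrite !gt_eqF.
have condS : n%:R * u / (n%:R * L) < C * p%:R `^ r by rewrite QE.
have Q1 : 1 <= Q by rewrite -QE; exact: LM_ge1 nL s0 eigLM.
have Q0 : 0 < Q by exact: lt_le_trans Q1.
have q0 : 0 <= q.
  have QQ : 0 < Q * Q `^ `|lam| by apply: mulr_gt0 => //; exact: powR_gt0.
  by rewrite ltW // (mulr_gt0 _ QQ) // mulr_gt0.
have q2 : 1 <= 1 + 2 * q by rewrite lerDl mulr_ge0.
have q1 : 1 <= Num.sqrt (1 + 2 * q).
  by rewrite -[leLHS]sqrtr1 ler_sqrt // (le_trans ler01 q2).
have h1 : 1 <= (Num.sqrt (1 - al))^-1.
  rewrite invf_ge1 ?sqrtr_gt0 ?subr_gt0 // -[leRHS]sqrtr1 ler_sqrt // gerBl.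
  exact: ltW.
have K1 : 1 <= Q `^ (`|lam| / 2) by apply: powR_ge1 => //; rewrite divr_ge0.
have m1 : 1 <= Num.max 1 c^-1 by rewrite le_max lexx.
have e1 : 1 <= expR kap by rewrite -expR0 ler_expR.
have rho0 : 0 < rho by exact: lt_trans rho1.
have f0 : 0 < fsize X a c s.
  rewrite /fsize sr divr_gt0 ?mulr_gt0 ?powR_gt0 //.
  rewrite big_ord_recl ltr_pwDl ?mulr_gt0 ?powR_gt0 //.
  by rewrite sumr_ge0 // => i _; rewrite mulr_ge0 // powR_ge0.
have piSge : fsize X a c s * (Q `^ (`|lam| / 2) * p%:R ^+ s)^-1 <= piS X lam a c C r S.
  rewrite /piS ler_pM2l // -QE; exact: piS_cond_ge condS.
have KP0 : 0 < Q `^ (`|lam| / 2) * p%:R ^+ s.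
  by rewrite mulr_gt0 ?exprn_gt0 // (lt_le_trans ltr01).
have piS0 : 0 < piS X lam a c C r S.
  by apply: lt_le_trans piSge; rewrite mulr_gt0 // invr_gt0.
have := @EPost_le R n p X s2 lam g al a c C r phi s20 g0 al01 bstar rho
  (n%:R * u) q rho0 s0 piS0 (size_gram_spec nL eigLM erefl) dl q0 _ _.
move=> /(_ _ _)/le_trans; apply.
- move=> UD H i; have /andP[_ ->] // := spec_dec_bounds eigLM i erefl H.
- move=> UD H i; rewrite /q -QE.
  exact: (@spec_ratio_le R n p X lam _ _ S nL s0 eigLM g al UD i g0 al0 H).
rewrite lee_fin -/S -/s; set dlow := expR _ * _.
have dlow_ge : (expR kap ^+ s)^-1 * (Num.sqrt (1 + 2 * q))^-1 ^+ s <= dlow.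
  apply: ler_wpM2r; first by rewrite exprn_ge0 // invr_ge0 sqrtr_ge0.
  rewrite -expRM_natl -expRN ler_expR mulNr lerN2 [leRHS]mulrC.
  exact: hkap.
pose Dl := fsize X a c s * (Q `^ (`|lam| / 2) * p%:R ^+ s)^-1 *
  ((expR kap ^+ s)^-1 * (Num.sqrt (1 + 2 * q))^-1 ^+ s).
have Dl0 : 0 < Dl.
  rewrite !mulr_gt0 ?invr_gt0 ?exprn_gt0 ?expR_gt0 // ?invr_gt0.
  exact: lt_le_trans q1.
have Dle : Dl <= piS X lam a c C r S * dlow.
  by apply: ler_pM => //; rewrite mulr_ge0 ?invr_ge0 // ltW.
set D := piS X lam a c C r S * dlow in Dle *.
have D0 : 0 < D by exact: lt_le_trans Dle.
pose h := (Num.sqrt (1 - al))^-1; rewrite -/h in h1 *.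
pose x := W * p%:R `^ (- eta); rewrite -/x in hx *.
have x0 : 0 <= x.
  by rewrite !mulr_ge0 ?powR_ge0 ?expR_ge0 ?sqrtr_ge0 ?invr_ge0 ?sqrtr_ge0 // (le_trans _ m1).
have term (k : nat) : rho * s%:R <= k%:R -> fsize X a c k * h ^+ k / Dl <= x ^+ k.
  move=> rk; have sk : (s <= k)%N.
    by rewrite -(ler_nat R); apply: le_trans rk; rewrite ler_peMl // ltW.
  have k0 : (0 < k)%N by exact: leq_trans sk.
  have lift (y : R) : 1 <= y -> y ^+ s <= y ^+ k by move=> y1; exact: ler_weXn2l.
  apply: le_trans (_ : (Num.max 1 c^-1 ^+ k * p%:R `^ (a * s%:R - a * k%:R) * fsize X a c s) *
     h ^+ k / Dl <= _).
    rewrite ler_pM2r ?invr_gt0 // ler_pM2r ?exprn_gt0 ?(lt_le_trans ltr01) //.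
    exact: fsize_ratio.
  have -> : (Num.max 1 c^-1 ^+ k * p%:R `^ (a * s%:R - a * k%:R) * fsize X a c s) *
     h ^+ k / Dl = Num.max 1 c^-1 ^+ k * Q `^ (`|lam| / 2) * expR kap ^+ s *
       Num.sqrt (1 + 2 * q) ^+ s * h ^+ k * (p%:R `^ (a * s%:R - a * k%:R) * p%:R ^+ s).
    rewrite /Dl exprVn; field.
    by rewrite ?expf_neq0 ?gt_eqF ?exprn_gt0 ?expR_gt0 ?(lt_le_trans ltr01 q1) ?(lt_le_trans ltr01 K1) ?(lt_le_trans ltr01 h1).
  rewrite /x exprMn; apply: ler_pM.
  - rewrite !mulr_ge0 ?exprn_ge0 ?expR_ge0 ?powR_ge0 ?sqrtr_ge0 //.
      exact: le_trans m1.
    exact: le_trans h1.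
  - by rewrite mulr_ge0 ?powR_ge0 // exprn_ge0 // ltW.
  - rewrite /W !exprMn -/h ler_pM2r ?exprn_gt0 ?(lt_le_trans ltr01) //.
    have nn (y : R) j : 1 <= y -> 0 <= y ^+ j.
      by move=> y1; rewrite exprn_ge0 // (le_trans _ y1).
    apply: ler_pM; rewrite ?lift //; rewrite ?mulr_ge0 ?nn ?powR_ge0 //.
    apply: ler_pM; rewrite ?lift //; rewrite ?mulr_ge0 ?nn ?powR_ge0 //.
    apply: ler_pM; rewrite ?nn ?powR_ge0 //.
    (* The constant comparing prior weights occurs only once; k > 0 lifts it too. *)
    by rewrite -[leLHS]expr1; exact: ler_weXn2l.
  (* The power of p is a s - a k from the size prior plus s from counting configurations, and s <= k
     / rho makes it at most -eta k. *)
  rewrite -!powR_mulrn ?powR_ge0 ?(ltW pR) // -powRrM -powRD; last first.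
    by rewrite (gt_eqF pR) implybT.
  apply: ler_powR => //; rewrite /eta mulNr mulrBl opprB.
  have -> : (a + 1) / rho * k%:R = (a + 1) * (k%:R / rho) by rewrite mulrAC mulrA.
  have : (a + 1) * s%:R <= (a + 1) * (k%:R / rho).
    by rewrite ler_pM2l ?addr_gt0 // ler_pdivlMr // mulrC.
  lra.
apply: le_trans (_ : \sum_(k < p) x ^+ k.+1 <= _); last exact: geometric_le.
have light (S' : {set 'I_p}) : #|S'|%:R < rho * s%:R ->
    heavy X lam a c C r (rho * s%:R) S' = 0.
  by move=> small; rewrite /heavy leNgt small.
have pw (S' : {set 'I_p}) : (#|S'| < p.+1)%N.
  by rewrite ltnS -[X in (_ <= X)%N](card_ord p) max_card.
(* Group by size. Size 0 is never heavy, so the index shifts to [k.+1] and the geometric series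
   starts at x. *)
rewrite (partition_big (fun S' => Ordinal (pw S')) predT) //= big_ord_recl /=.
rewrite big1 ?add0r => [|S' /eqP/(congr1 val)/= S'0]; last first.
  by rewrite light ?mul0r // S'0 mulr_gt0.
apply: ler_sum => k _; set kk := lift ord0 k.
have kkE : nat_of_ord kk = k.+1 by [].
have sizeE (S' : {set 'I_p}) : (Ordinal (pw S') == kk) = (#|S'| == k.+1) by [].
have [big|small] := leP (rho * s%:R) k.+1%:R; last first.
  rewrite big1 ?exprn_ge0 // => S'; rewrite sizeE => /eqP S'k.
  by rewrite light ?mul0r // S'k.
apply: le_trans (term _ big).
apply: (@le_trans _ _ (\sum_(S' : {set 'I_p} | #|S'| == k.+1)
    piS X lam a c C r S' * (h ^+ k.+1 / D))).
  under eq_bigl do rewrite sizeE.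
  apply: ler_sum => S' /eqP S'k; rewrite S'k -mulrA; apply: ler_wpM2r.
    by rewrite mulr_ge0 ?invr_ge0 ?exprn_ge0 ?(le_trans _ h1) // ltW.
  by rewrite /heavy; case: ifP => // _; exact: piS_ge0.
rewrite -mulr_suml mulrA; apply: ler_pM; rewrite ?invr_ge0 ?(ltW D0) //.
- by rewrite mulr_ge0 ?exprn_ge0 ?(le_trans _ h1) // sumr_ge0 // => S' _; exact: piS_ge0.
- by rewrite ler_wpM2r ?exprn_ge0 ?(le_trans _ h1) //; exact: sum_piS.
- by rewrite lef_pV2.
Qed.

End Rate.

(** * Eventual inequalities extracted from limits *)

Section Limits.
Context {R : realType}.

Lemma near_gt_limn_einf (u : (\bar R)^nat) x : (x < limn_einf u)%E ->
  \forall n \near \oo, (x < u n)%E.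
Proof.
rewrite limn_einf_lim (cvg_lim _ (@cvg_einfs_sup R u)) //.
move=> /ereal_sup_gt[_ [N _ <-] xN]; exists N => // n /= Nn.
by apply: lt_le_trans xN _; apply: ereal_inf_lbound; exists n.
Qed.

Lemma near_lt_limn_esup (u : (\bar R)^nat) x : (limn_esup u < x)%E ->
  \forall n \near \oo, (u n < x)%E.
Proof.
move=> h; have := @near_gt_limn_einf (-%E \o u) (- x)%E.
rewrite limn_einfN lteN2 => /(_ h); apply: filterS => n /=.
by rewrite lteN2.
Qed.

Lemma near_powR_gt (p : nat -> nat) (A t : R) : 0 < t ->
  (\forall n \near \oo, n%:R <= (p n)%:R :> R) ->
  \forall n \near \oo, A < (p n)%:R `^ t.
Proof.
move=> t0 np; pose B := (`|A| + 1) `^ t^-1.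
have A1 : 0 < `|A| + 1 by rewrite ltr_wpDl.
near=> n; apply: (@lt_le_trans _ _ (B `^ t)).
  rewrite /B -powRrM mulVf ?gt_eqF // powRr1 ?ltW //.
  by apply: le_lt_trans (ler_norm A) _; rewrite ltrDl.
apply: (ge0_ler_powR (ltW t0)); rewrite ?nnegrE ?powR_ge0 //.
apply: le_trans (_ : n%:R <= _); last by near: n.
by near: n; exact: nbhs_infty_ger.
Unshelve. all: by end_near. Qed.

End Limits.

Unset Implicit Arguments.
Set Strict Implicit.
Set Printing Implicit Defensive.

Theorem theorem2 (R : realType) (sigma2 lam g alpha a c C r rho : R)
  (p : nat -> nat) (X : forall n : nat, 'M[R]_(n, p n)) (phi : nat -> R)
  (bstar : forall n : nat, 'cV[R]_(p n)) :
  let sstar := fun n : nat => #|supp (bstar n)| in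
  let mlam := Num.max (1 + lam) (Num.max 1 (- lam)) in
  let rho0 := (a + 1) / (a - r * mlam) in
  0 < sigma2 -> 0 < g -> 0 < alpha < 1 ->
  0 < a -> 0 < c -> 0 < C -> 0 < r ->
  (forall n, 0 < phi n < 1) ->
  r * mlam < a ->
  rho0 < rho ->
  (* standing model: s* <= R = rank X <= n << p *)
  (forall n, (sstar n <= \rank (X n))%N) ->
  ((fun n : nat => n%:R / (p n)%:R : R) @ \oo --> 0) ->
  (* (A1) *)
  ((fun n : nat => (sstar n)%:R / n%:R : R) @ \oo --> 0) ->
  (* (A2) *)
  ((fun n : nat => (sstar n)%:R / (n%:R * enorm (bstar n)) : R) @ \oo --> 0) ->
  (exists K : R, \forall n \near \oo,
      `|1 - phi n| <= K * ((sstar n)%:R / (n%:R * enorm (bstar n)))) ->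
  (* (A3) *)
  (0 < limn_einf (fun n => (ell (X n) (sstar n))%:E))%E ->
  (limn_einf (fun n => (ell (X n) (sstar n))%:E)
     < limn_esup (fun n => (uu (X n) (sstar n))%:E))%E ->
  (limn_esup (fun n => (uu (X n) (sstar n))%:E) < +oo)%E ->
  (fun n : nat => EPost (X n) sigma2 lam g alpha a c C r (phi n) (bstar n)
                        (Uset rho (sstar n))) @ \oo --> 0%E.
Proof.
move=> sstar mlam rho0 s20 g0 alpha01 a0 c0 C0 r0 phi01 ram rhoL rk np _ A2 [K HK].
move=> einf _ esup; have [alpha0 alpha1] := andP alpha01.
have ml1 : 1 <= mlam by rewrite /mlam !le_max lexx orbT.
(* From (a - r mlam) rho > a + 1 and r mlam rho > 0; this is what makes [eta] positive. *)
have arho : a + 1 < a * rho.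
  have d0 : 0 < a - r * mlam by rewrite subr_gt0.
  have rm0 : 0 < r * mlam by rewrite mulr_gt0 // (lt_le_trans ltr01).
  move: rhoL; rewrite /rho0 ltr_pdivrMr // => h.
  have rp : 0 < rho.
    rewrite -(pmulr_lgt0 _ d0); apply: lt_trans h.
    by rewrite addr_gt0.
  have : 0 < rho * (r * mlam) by exact: mulr_gt0.
  by lra.
have rho1 : 1 < rho.
  rewrite -(ltr_pM2l a0); apply: lt_trans arho; by rewrite mulr1 ltrDl.
have rhop : 0 < rho by exact: lt_trans rho1.
pose eta := a - (a + 1) / rho.
have eta0 : 0 < eta by rewrite subr_gt0 ltr_pdivrMr.
have [L L0 Ll] : exists2 L : R, 0 < L & \forall n \near \oo, L < ell (X n) (sstar n).
  (* The lower limit may be [+oo]; any positive [L] then serves. *)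
  have [L L0 h] : exists2 L : R, 0 < L &
      (L%:E < limn_einf (fun n => (ell (X n) (sstar n))%:E))%E.
    case: (limn_einf _) einf => [l||] //=; rewrite ?lte_fin => l0.
      by exists (l / 2); rewrite ?lte_fin; lra.
    by exists 1 => //; exact: ltry.
  by exists L => //; apply: filterS (near_gt_limn_einf h) => n; rewrite lte_fin.
have [u u0 uU] : exists2 u : R, 0 < u & \forall n \near \oo, uu (X n) (sstar n) < u.
  have [u u0 h] : exists2 u : R, 0 < u &
      (limn_esup (fun n => (uu (X n) (sstar n))%:E) < u%:E)%E.
    case: (limn_esup _) esup => [l||] //= _.
      exists (`|l| + 1); first by rewrite ltr_wpDl.
      by rewrite lte_fin; apply: le_lt_trans (ler_norm l) _; rewrite ltrDl.
    by exists 1 => //; exact: ltNyr.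
  by exists u => //; apply: filterS (near_lt_limn_esup h) => n; rewrite lte_fin.
pose t n : R := (sstar n)%:R / (n%:R * enorm (bstar n)).
have t0 n : 0 <= t n by rewrite divr_ge0 // mulr_ge0 // sqrtr_ge0.
(* [s* = 0] would force [phi n = 1] in (A2), since x / 0 = 0. *)
have tpos : \forall n \near \oo, t n != 0.
  apply: filterS HK => n; rewrite -/(t n); apply: contraTneq => ->.
  by rewrite mulr0 -ltNge normr_gt0 subr_eq0 gt_eqF //; have /andP[] := phi01 n.
have tposP n : t n != 0 -> [/\ (0 < sstar n)%N, (0 < n)%N & enorm (bstar n) != 0].
  rewrite /t mulf_eq0 invr_eq0 mulf_eq0 !negb_or !pnatr_eq0 -!lt0n.
  by move=> /and3P[].
have leqsn n : (sstar n <= n)%N by apply: leq_trans (rk n) (rank_leq_row _).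
have nlep : \forall n \near \oo, n%:R <= (p n)%:R :> R.
  move/cvgr0Pnorm_le : np => /(_ 1 ltr01) np1; near=> n.
  have [sn _ _] : [/\ (0 < sstar n)%N, (0 < n)%N & enorm (bstar n) != 0].
    by apply: tposP; near: n.
  (* With [p n = 0] the quotient would be 0 and say nothing about n. *)
  have pn : (0 < p n)%N by rewrite (leq_trans sn) // (leq_trans (rk n)) // rank_leq_col.
  have : `|n%:R / (p n)%:R : R| <= 1 by near: n.
  by rewrite ger0_norm ?divr_ge0 // ler_pdivrMr ?ltr0n // mul1r.
(* [kap] is the cost per true coefficient of centring at phi betahat: 2 alpha u / sigma2 times the
   K^2 of (1 - phi)^2 n |beta^\star|^2 <= K^2 s^\star. *)
pose Q := u / L; pose kap := 2 * alpha * u * K ^+ 2 / sigma2.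
pose q := alpha * g * (Q * Q `^ `|lam|).
pose W := Num.max 1 c^-1 * Q `^ (`|lam| / 2) * expR kap *
  Num.sqrt (1 + 2 * q) * (Num.sqrt (1 - alpha))^-1.
have W0 : 0 <= W.
  rewrite !mulr_ge0 ?powR_ge0 ?expR_ge0 ?sqrtr_ge0 ?invr_ge0 ?sqrtr_ge0 //.
  by rewrite le_max ler01.
apply: (@squeeze_cvge _ _ _ _ (fun=> 0%E) _
  (fun n => (2 * (W * (p n)%:R `^ (- eta)))%:E)); last 2 first.
- exact: cvg_cst.
- apply: cvg_EFin; first exact: nearW.
  apply/cvgr0Pnorm_le => eps eps0; near=> n.
  rewrite [X in `|X|](_ : _ = 2 * (W * (p n)%:R `^ (- eta))) //.
  rewrite ger0_norm; last by rewrite mulr_ge0 // mulr_ge0 // powR_ge0.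
  rewrite powRN mulrA.
  have h : 2 * W / eps < (p n)%:R `^ eta by near: n; exact: near_powR_gt.
  rewrite ler_pdivrMr; last by apply: le_lt_trans h; rewrite divr_ge0 ?(ltW eps0) // mulr_ge0.
  by move: h; rewrite ltr_pdivrMr // [ltRHS]mulrC => /ltW.
near=> n; rewrite EPost_ge0 /=.
have [sn nn en] : [/\ (0 < sstar n)%N, (0 < n)%N & enorm (bstar n) != 0].
  by apply: tposP; near: n.
have nR : 0 < n%:R :> R by rewrite ltr0n.
have Kt : `|1 - phi n| <= K * t n by near: n.
have Kt2 : (1 - phi n) ^+ 2 <= K ^+ 2 * t n ^+ 2.
  by rewrite -exprMn -real_normK ?num_real // lerXn2r ?nnegrE // (le_trans _ Kt).
(* The norm of the signal cancels against its inverse in (A2); the remaining s^\star^2 / n is at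
   most s^\star because s^\star <= n. *)
have t2 : t n ^+ 2 * (n%:R * sqnorm (bstar n)) = (sstar n)%:R ^+ 2 / n%:R.
  rewrite (_ : sqnorm (bstar n) = enorm (bstar n) ^+ 2); last first.
    by rewrite sqr_sqrtr // sqnorm_ge0.
  by rewrite /t; field; rewrite gt_eqF.
apply: (EPost_rate (kap := kap) (L := L) (u := u)) => //.
- rewrite /kap divr_ge0 ?(ltW s20) // mulr_ge0 ?sqr_ge0 //.
  by rewrite ltW // !mulr_gt0.
- exact: rk.
- by near: n.
- by near: n.
(* The cutoff C p^r grows without bound, so the true model eventually meets it. *)
- have h : u / L / C < (p n)%:R `^ r by near: n; exact: near_powR_gt.
  by move: h; rewrite ltr_pdivrMr // [ltRHS]mulrC.
(* The threshold gives |1 - phi n| <= 1/2; it uses |K| + 1 to be positive whatever [K] is. *)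
- have : t n <= (2 * (`|K| + 1))^-1.
    near: n; move/cvgr0Pnorm_le : A2 => /(_ (2 * (`|K| + 1))^-1).
    rewrite invr_gt0 mulr_gt0 ?ltr_wpDl // => /(_ isT).
    by apply: filterS => m; exact: le_trans (ler_norm _).
  have K1 : 0 < `|K| + 1 by rewrite ltr_wpDl.
  rewrite invfM ler_pdivlMr // => h.
  have h2 : K * t n <= 2^-1.
    apply: le_trans h; rewrite mulrC ler_wpM2l //.
    by apply: le_trans (ler_norm K) _; rewrite lerDl.
  have : `|1 - phi n| ^+ 2 <= 2^-1 ^+ 2.
    by rewrite lerXn2r ?nnegrE ?invr_ge0 // (le_trans Kt).
  by rewrite real_normK ?num_real // !expr2; lra.
- have sb : (sstar n)%:R ^+ 2 / n%:R <= (sstar n)%:R :> R.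
    by rewrite ler_pdivrMr // expr2 ler_wpM2l // ler_nat.
  have main : (1 - phi n) ^+ 2 * (n%:R * sqnorm (bstar n)) <=
      K ^+ 2 * (sstar n)%:R.
    apply: (@le_trans _ _ (K ^+ 2 * t n ^+ 2 * (n%:R * sqnorm (bstar n)))).
      by rewrite ler_wpM2r // mulr_ge0 // sqnorm_ge0.
    by rewrite -mulrA t2 ler_wpM2l // sqr_ge0.
  have k0 : 0 <= 2 * alpha * u / sigma2.
    by rewrite divr_ge0 ?(ltW s20) // ltW // !mulr_gt0.
  have := ler_wpM2l k0 main; rewrite /kap -/(sstar n).
  rewrite !mulrA; set v := (X in X <= _ -> _); set w := (X in _ -> X <= _).
  set v' := (X in _ <= X -> _); set w' := (X in _ -> _ <= X).
  have -> : w = v by rewrite /w /v; field; rewrite gt_eqF.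
  by have -> : w' = v' by rewrite /w' /v'; field; rewrite gt_eqF.
- have h : 2 * W < (p n)%:R `^ eta by near: n; exact: near_powR_gt.
  rewrite powRN -/kap -/Q -/q -/W.
  rewrite ler_pdivrMr; last by apply: le_lt_trans h; rewrite mulr_ge0.
  by move: h; lra.
Unshelve. all: by end_near. Qed.
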